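(* Let $(X,d_X)$ and $(Y,d_Y)$ be uniformly locally finite metric spaces. If the uniform Roe algebras $\mathrm{C}^*_u(X)$ and $\mathrm{C}^*_u(Y)$ are $^*$-isomorphic, then $X$ and $Y$ are bijectively coarsely equivalent.
   Context: A metric space $(X,d)$ is uniformly locally finite (u.l.f.) if $\sup_{x\in X}|B_r(x)|<\infty$ for every $r>0$, where $B_r(x)$ is the ball of radius $r$ about $x$. For an $X$-by-$X$ complex matrix $a=[a_{x,x'}]$, its propagation is $\sup\{d(x,x')\mid a_{x,x'}\neq 0\}$; finite propagation matrices with uniformly bounded entries define bounded operators on $\ell_2(X)$. The uniform Roe algebra $\mathrm{C}^*_u(X)$ is the norm closure in $\mathcal B(\ell_2(X))$ of the $^*$-algebra of finite propagation operators. A map $f\colon X\to Y$ is coarse if for every $r>0$ there is $s>0$ with $d_X(x,x')\le r\Rightarrow d_Y(f(x),f(x'))\le s$; maps $f,g\colon X\to Y$ are close if $\sup_x d_Y(f(x),g(x))<\infty$; $f$ is a coarse equivalence if there is a coarse $g\colon Y\to X$ with $f\circ g$ close to $\mathrm{Id}_Y$ and $g\circ f$ close to $\mathrm{Id}_X$. $X$ and $Y$ are bijectively coarsely equivalent if there is a bijective coarse equivalence $X\to Y$. *)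

(* Defs.v *)
From mathcomp Require Import all_boot all_order all_algebra.
From mathcomp Require Import reals complex.
Set Implicit Arguments. Unset Strict Implicit. Unset Printing Implicit Defensive.
Import Order.TTheory GRing.Theory Num.Theory.
Local Open Scope ring_scope.
Local Open Scope complex_scope.

Section Defs.
Variable R : realType.
Local Notation C := R[i].

Definition is_metric (X : Type) (d : X -> X -> R) : Prop :=
  (forall x, d x x = 0) /\ (forall x y, d x y = 0 -> x = y) /\
  (forall x y, d x y = d y x) /\ (forall x y z, d x z <= d x y + d y z).

(* u.l.f.: for every r > 0, the balls B_r(x) = {x' | d x x' <= r} have
   uniformly bounded (finite) cardinality: any duplicate-free list of points
   of B_r(x) has length <= N, with N independent of x. *)
Definition ulf (X : eqType) (d : X -> X -> R) : Prop :=
  forall r : R, 0 < r -> exists N : nat, forall (x : X) (s : seq X),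
    uniq s -> (forall y, y \in s -> d x y <= r) -> (size s <= N)%N.

Definition coarse (X Y : Type) (dX : X -> X -> R) (dY : Y -> Y -> R)
  (f : X -> Y) : Prop :=
  forall r : R, 0 < r -> exists s : R, 0 < s /\
    forall x x', dX x x' <= r -> dY (f x) (f x') <= s.

Definition close (X Y : Type) (dY : Y -> Y -> R) (f g : X -> Y) : Prop :=
  exists M : R, forall x, dY (f x) (g x) <= M.

Definition coarse_equivalence (X Y : Type) (dX : X -> X -> R)
  (dY : Y -> Y -> R) (f : X -> Y) : Prop :=
  coarse dX dY f /\ exists g : Y -> X, coarse dY dX g /\
    close dY (f \o g) id /\ close dX (g \o f) id.

Definition bij_coarse_equiv (X Y : Type) (dX : X -> X -> R)
  (dY : Y -> Y -> R) : Prop :=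
  exists f : X -> Y, bijective f /\ coarse_equivalence dX dY f.

(* ---------- X-by-X complex matrices as operators on l2(X) ---------- *)
Definition mat (X : Type) := X -> X -> C.

(* finite sums over a finite duplicate-free support s *)
Definition sqnorm (X : Type) (s : seq X) (xi : X -> C) : C :=
  \sum_(x <- s) `|xi x| ^+ 2.

Definition form (X : Type) (s : seq X) (a : mat X) (eta xi : X -> C) : C :=
  \sum_(x <- s) \sum_(x' <- s) (eta x)^* * a x x' * xi x'.

(* ||a|| <= M as an operator on l2(X): tested on finitely supported vectors
   (which are dense), via |<eta, a xi>| <= M for unit eta, xi. *)
Definition opnorm_le (X : eqType) (a : mat X) (M : C) : Prop :=
  forall (s : seq X) (eta xi : X -> C), uniq s ->
    sqnorm s xi <= 1 -> sqnorm s eta <= 1 -> `|form s a eta xi| <= M.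

Definition bounded_mat (X : eqType) (a : mat X) : Prop :=
  exists M : C, opnorm_le a M.

Definition propagation_le (X : Type) (d : X -> X -> R) (a : mat X) (r : R) :=
  forall x x', a x x' != 0 -> d x x' <= r.

Definition finite_propagation (X : Type) (d : X -> X -> R) (a : mat X) :=
  (exists r : R, propagation_le d a r) /\
  (exists M : R, forall x x', `|a x x'| <= M%:C).

Definition uroe (X : eqType) (d : X -> X -> R) (a : mat X) : Prop :=
  bounded_mat a /\
  forall eps : R, 0 < eps -> exists b : mat X,
    finite_propagation d b /\ opnorm_le (fun x x' => a x x' - b x x') eps%:C.

Definition madd (X : Type) (a b : mat X) : mat X := fun x x' => a x x' + b x x'.
Definition mscale (X : Type) (l : C) (a : mat X) : mat X := fun x x' => l * a x x'.
Definition madj (X : Type) (a : mat X) : mat X := fun x x' => (a x' x)^*.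

(* c = a b : each entry c x z is the (unconditionally convergent) sum
   sum_y a x y * b y z, i.e. the limit of the net of finite partial sums *)
Definition mmul_rel (X : eqType) (a b c : mat X) : Prop :=
  forall (x z : X) (eps : R), 0 < eps -> exists F0 : seq X,
    forall F : seq X, uniq F -> {subset F0 <= F} ->
      `|\sum_(y <- F) a x y * b y z - c x z| <= eps%:C.

Definition star_iso (X Y : eqType) (dX : X -> X -> R) (dY : Y -> Y -> R)
  (phi : mat X -> mat Y) : Prop :=
  (forall a, uroe dX a -> uroe dY (phi a)) /\
  (forall a b, uroe dX a -> uroe dX b -> phi a = phi b -> a = b) /\
  (forall c, uroe dY c -> exists2 a, uroe dX a & phi a = c) /\
  (forall a b, uroe dX a -> uroe dX b -> phi (madd a b) = madd (phi a) (phi b)) /\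
  (forall l a, uroe dX a -> phi (mscale l a) = mscale l (phi a)) /\
  (forall a, uroe dX a -> phi (madj a) = madj (phi a)) /\
  (forall a b c, uroe dX a -> uroe dX b -> uroe dX c ->
     mmul_rel a b c -> mmul_rel (phi a) (phi b) (phi c)).

Definition uroe_isomorphic (X Y : eqType) (dX : X -> X -> R)
  (dY : Y -> Y -> R) : Prop :=
  exists phi : mat X -> mat Y, star_iso dX dY phi.

End Defs.

(* Main.v *)
Require Import Defs.
From mathcomp Require Import all_boot all_order all_algebra.
From mathcomp Require Import reals complex boolp classical_sets finmap.
From mathcomp Require Import ring lra zify.

(** An isomorphism [phi] with inverse [psi] sends the rank one projections
    [e_yy] to rank one projections [v_y v_y^*], where [(v_y)] is an orthonormal
    basis of [l2(X)]; dually [phi e_xx = u_x u_x^*] with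
    [|u_x(y)| = |v_y(x)|].  Every [psi (chi S)] lies in the uniform Roe algebra,
    so a Baire category argument over the subsets [S] of [Y] makes these
    projections quasi-local uniformly in [S].

    The idea that replaces property A: for finitely supported [xi] one can
    choose signs with [|| 1_Z (sum_y +-<v_y, xi> v_y) ||^2 >=
    sum_y |<v_y, xi>|^2 || 1_Z v_y ||^2], whereas uniform quasi-locality makes the
    left side small when [Z] is far from the support of [xi].  For
    [xi = delta_x] this gives a uniform lower bound for [sup_y |v_y(x)|]; hence
    each [v_y] is concentrated near a point [g y], and [g] and its dual [f]
    are mutually inverse coarse maps.  For [xi] supported on a finite [A] and
    orthogonal to all [v_y] with [g y] near [A] it gives a contradiction, so
    there are at least [|A|] such [y]: this is Hall's condition.  Hall's theorem
    in both directions and the Cantor-Bernstein argument then produce a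
    bijection close to [f]. *)

Set Implicit Arguments.
Unset Strict Implicit.
Unset Printing Implicit Defensive.
Import Order.TTheory GRing.Theory Num.Theory.
Local Open Scope ring_scope.
Local Open Scope complex_scope.

(** * Squared moduli and finite l2 norms *)

Section SquaredNorms.
Variable R : realType.
Local Notation C := R[i].
Local Notation cj := (@conjc R).
Implicit Types z w : C.

(** No Hilbert space is built: operators are matrices, and estimates bound squared norms of finitely
    supported vectors, kept real-valued through [nn] and [ns]. A squared norm of a sum costs a
    factor 2, whence the powers of two in the constants. A [star_iso] is purely algebraic: neither
    continuity nor an implementing unitary is given. Uniform norm bounds are needed only on the
    projections [psi (chi S)], where self-adjointness and idempotence yield them; the strong
    continuity in [S] on which the Baire argument rests is deduced from the unit norm of the dual
    vectors u_x. The obstacle is that quasi-locality alone does not prevent all entries of an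
    operator from being small, as ghosts show. Signs help because sum_y +-v_y v_y^* is a difference
    of two projections [psi (chi S)]: its quasi-locality radius is fixed before the signs, which may
    then depend on the vector xi and on the set Z. *)

Definition nn z : R := complex.Re z ^+ 2 + complex.Im z ^+ 2.

Lemma nn_ge0 z : 0 <= nn z.
Proof. by rewrite addr_ge0 // sqr_ge0. Qed.

Lemma nnM z w : nn (z * w) = nn z * nn w.
Proof. by case: z w => a b [c d]; rewrite /nn /=; ring. Qed.

Lemma nn_conj z : nn (cj z) = nn z.
Proof. by case: z => a b; rewrite /nn /=; ring. Qed.

Lemma conjcM z w : cj (z * w) = cj z * cj w.
Proof. exact: rmorphM. Qed.

Lemma conj_real_complex (r : R) : cj r%:C = r%:C.
Proof. by rewrite /= oppr0. Qed.

Lemma real_complexM (r t : R) : (r * t)%:C = r%:C * t%:C.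
Proof. exact: rmorphM. Qed.

Lemma nnN z : nn (- z) = nn z.
Proof. by case: z => a b; rewrite /nn /=; ring. Qed.

Lemma nn0 : nn 0 = 0.
Proof. by rewrite /nn /=; ring. Qed.

Lemma nn1 : nn 1 = 1.
Proof. by rewrite /nn /=; ring. Qed.

Lemma nn_eq0 z : (nn z == 0) = (z == 0).
Proof.
by rewrite /nn paddr_eq0 ?sqr_ge0 // !expf_eq0 /= eq_complex.
Qed.

Lemma nn_real (r : R) : nn r%:C = r ^+ 2.
Proof. by rewrite /nn /=; ring. Qed.

Lemma nnE z : z * cj z = (nn z)%:C.
Proof.
by case: z => a b; apply/eqP; rewrite eq_complex /nn /=; apply/andP; split;
  apply/eqP; ring.
Qed.

Lemma normsqE z : `|z| ^+ 2 = (nn z)%:C.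
Proof. by rewrite -add_Re2_Im2. Qed.

Lemma norm_nn z (M : R) : 0 <= M -> (`|z| <= M%:C) = (nn z <= M ^+ 2).
Proof.
move=> M0; rewrite normc_def lecR.
by rewrite -[RHS]ler_sqrt ?sqr_ge0 // sqrtr_sqr (ger0_norm M0).
Qed.

Lemma nnD z w : nn (z + w) <= 2 * nn z + 2 * nn w.
Proof.
case: z w => a b [c d]; rewrite /nn /=.
have := sqr_ge0 (a - c); have := sqr_ge0 (b - d); nra.
Qed.

Lemma Re_sum (T : Type) (s : seq T) (f : T -> C) :
  complex.Re (\sum_(x <- s) f x) = \sum_(x <- s) complex.Re (f x).
Proof.
by elim: s => [|x s IH]; rewrite ?big_nil ?big_cons //= -IH;
  case: (f x) (\sum_(_ <- _) _) => ? ? [].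
Qed.

Lemma Im_sum (T : Type) (s : seq T) (f : T -> C) :
  complex.Im (\sum_(x <- s) f x) = \sum_(x <- s) complex.Im (f x).
Proof.
by elim: s => [|x s IH]; rewrite ?big_nil ?big_cons //= -IH;
  case: (f x) (\sum_(_ <- _) _) => ? ? [].
Qed.

Lemma conjc_sum (T : Type) (s : seq T) (f : T -> C) :
  cj (\sum_(x <- s) f x) = \sum_(x <- s) cj (f x).
Proof. exact: rmorph_sum. Qed.

Lemma ReD z w : complex.Re (z + w) = complex.Re z + complex.Re w.
Proof. by case: z w => ? ? []. Qed.

Lemma ImD z w : complex.Im (z + w) = complex.Im z + complex.Im w.
Proof. by case: z w => ? ? []. Qed.

Lemma ReN z : complex.Re (- z) = - complex.Re z.
Proof. by case: z. Qed.

Lemma ImN z : complex.Im (- z) = - complex.Im z.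
Proof. by case: z. Qed.

Lemma Re_conjM_le z w : complex.Re (cj z * w) <= (nn z + nn w) / 2.
Proof.
case: z w => a b [c d]; rewrite /nn /=.
have := sqr_ge0 (a - c); have := sqr_ge0 (b - d); nra.
Qed.

Lemma Re_le_nn z (e : R) : 0 <= e -> nn z <= e ^+ 2 -> `|complex.Re z| <= e.
Proof.
move=> e0 H; rewrite -(ler_pXn2r (n := 2)) ?nnegrE // real_normK ?num_real //.
by rewrite (le_trans _ H) // /nn lerDl sqr_ge0.
Qed.

Section VectorNorms.
Variable T : eqType.
Implicit Types (s t F : seq T) (f g : T -> C).

Definition ns s f : R := \sum_(x <- s) nn (f x).

Lemma ns_ge0 s f : 0 <= ns s f.
Proof. by apply: sumr_ge0 => x _; apply: nn_ge0. Qed.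

Lemma ns_cons x s f : ns (x :: s) f = nn (f x) + ns s f.
Proof. by rewrite /ns big_cons. Qed.

Lemma ns1 x f : ns [:: x] f = nn (f x).
Proof. by rewrite /ns big_seq1. Qed.

Lemma eq_ns s f g : {in s, f =1 g} -> ns s f = ns s g.
Proof. by move=> H; apply: eq_big_seq => x /H ->. Qed.

Lemma nsD s f g : ns s (fun x => f x + g x) <= 2 * ns s f + 2 * ns s g.
Proof.
rewrite /ns !mulr_sumr -big_split /=; apply: ler_sum => x _; exact: nnD.
Qed.

Lemma nsN s f : ns s (fun x => - f x) = ns s f.
Proof. by apply: eq_bigr => x _; rewrite nnN. Qed.

Lemma nsZ s f z : ns s (fun x => f x * z) = ns s f * nn z.
Proof. by rewrite /ns mulr_suml; apply: eq_bigr => x _; rewrite nnM. Qed.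

Lemma ler_sum_subset s t (f : T -> R) : (forall x, 0 <= f x) -> uniq s ->
  {subset s <= t} -> \sum_(x <- s) f x <= \sum_(x <- t) f x.
Proof.
move=> f0; elim: s t => [|x s IH] t /= us st.
  by rewrite big_nil sumr_ge0.
have xt : x \in t by apply: st; rewrite mem_head.
rewrite big_cons (perm_big _ (perm_to_rem xt)) /= big_cons lerD2l.
case/andP: us => xs us; apply: IH => // y ys.
have : y \in t by apply: st; rewrite inE ys orbT.
rewrite (perm_mem (perm_to_rem xt)) inE => /orP[/eqP yx|//].
by rewrite -yx ys in xs.
Qed.

Lemma ns_subset s t f : uniq s -> {subset s <= t} -> ns s f <= ns t f.
Proof. by move=> us st; apply: ler_sum_subset => // x; apply: nn_ge0. Qed.

Lemma ns_filter (p : pred T) s f :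
  ns s f = ns (filter p s) f + ns (filter (predC p) s) f.
Proof.
rewrite /ns !big_filter; elim: s => [|x s IH]; first by rewrite !big_nil addr0.
by rewrite !big_cons IH /=; case: (p x) => /=; ring.
Qed.

Lemma ns_eq0 s f : ns s f <= 0 -> {in s, forall x, f x = 0}.
Proof.
elim: s => [//|x s IH]; rewrite ns_cons => H y.
have f0 := nn_ge0 (f x); have s0 := ns_ge0 s f.
rewrite inE => /orP[/eqP ->|ys]; last by apply: IH => //; lra.
by apply/eqP; rewrite -nn_eq0; apply/eqP; lra.
Qed.

Lemma ip_le s f g :
  complex.Re (\sum_(x <- s) cj (f x) * g x) <= (ns s f + ns s g) / 2.
Proof.
rewrite Re_sum /ns -big_split /= mulr_suml; apply: ler_sum => x _.
exact: Re_conjM_le.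
Qed.

Lemma ip_self s f : \sum_(x <- s) cj (f x) * f x = (ns s f)%:C.
Proof.
rewrite /ns rmorph_sum; apply: eq_bigr => x _; rewrite mulrC; exact: nnE.
Qed.

Lemma exists_phase z : exists l : C, nn l = 1 /\ l * z = (Num.sqrt (nn z))%:C.
Proof.
have [->|z0] := eqVneq z 0.
  by exists 1; rewrite nn1 nn0 sqrtr0 mulr0.
have n0 : 0 < nn z by rewrite lt_neqAle nn_ge0 eq_sym nn_eq0 z0.
set r := Num.sqrt (nn z).
have r0 : 0 < r by rewrite sqrtr_gt0.
have r2 : r ^+ 2 = nn z by rewrite sqr_sqrtr // ltW.
exists ((r^-1)%:C * cj z); split.
  rewrite nnM nn_conj nn_real -r2; field; exact: lt0r_neq0.
rewrite -mulrA [cj z * z]mulrC nnE -rmorphM /= -r2; congr (_%:C).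
field; exact: lt0r_neq0.
Qed.

(** [ip_le] for the multiples [a f] and [b l g], where the phase [l] makes the sum real and
    nonnegative, gives [2 a b r <= a^2 |f|^2 + b^2 |g|^2] for all real [a], [b], with [r] the
    modulus of the sum. *)
Lemma cauchy_schwarz s f g :
  nn (\sum_(x <- s) cj (f x) * g x) <= ns s f * ns s g.
Proof.
set z := \sum_(x <- s) _.
have [l [l1 lz]] := exists_phase z.
set r := Num.sqrt (nn z) in lz.
have r0 : 0 <= r by apply: sqrtr_ge0.
have r2 : r ^+ 2 = nn z by rewrite sqr_sqrtr // nn_ge0.
have F0 := ns_ge0 s f; have G0 := ns_ge0 s g.
have key : forall a b : R, 2 * a * b * r <= a ^+ 2 * ns s f + b ^+ 2 * ns s g.
  move=> a b.
  have := ip_le s (fun x => a%:C * f x) (fun x => (b%:C * l) * g x).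
  have -> : ns s (fun x => a%:C * f x) = a ^+ 2 * ns s f.
    by rewrite /ns mulr_sumr; apply: eq_bigr => x _; rewrite nnM nn_real.
  have -> : ns s (fun x => b%:C * l * g x) = b ^+ 2 * ns s g.
    by rewrite /ns mulr_sumr; apply: eq_bigr => x _;
      rewrite !nnM nn_real l1 mulr1.
  have -> : \sum_(x <- s) cj (a%:C * f x) * (b%:C * l * g x) = (a * b * r)%:C.
    rewrite !real_complexM -lz /z !mulr_sumr; apply: eq_bigr => x _.
    by rewrite conjcM conj_real_complex; ring.
  by move=> /= H; lra.
rewrite -r2.
have [f0|f0] := eqVneq (ns s f) 0.
  (* For [ns s f = 0] this choice reads [(ns s g + 2) r^2 <= 0]. *)
  have := key (ns s g + 1) r; rewrite f0.
  have := sqr_ge0 r; nra.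
have fp : 0 < ns s f by rewrite lt_neqAle eq_sym f0.
rewrite -(ler_pM2l fp).
have := key r (ns s f); nra.
Qed.

(** Testing with [g := f] gives [(ns s f)^2 <= K * ns s f], to be divided by [ns s f] unless that is
    zero. *)
Lemma ns_dual s f (K : R) : 0 <= K ->
  (forall g, nn (\sum_(x <- s) cj (g x) * f x) <= K * ns s g) -> ns s f <= K.
Proof.
move=> K0 /(_ f); rewrite ip_self nn_real => H; have := ns_ge0 s f.
by rewrite le_eqVlt => /orP[/eqP <- //|f0]; rewrite -(ler_pM2r f0) -expr2.
Qed.

End VectorNorms.
End SquaredNorms.

(** * Matrices acting on finitely supported vectors *)

Section Operators.
Variables (R : realType) (X : eqType).
Local Notation C := R[i].
Local Notation cj := (@conjc R).
Implicit Types (a b c : mat R X) (s t F : seq X) (xi eta : X -> C).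

Definition app t a xi : X -> C := fun x => \sum_(z <- t) a x z * xi z.

(* [K] bounds the square of the operator norm. *)
Definition opb a (K : R) := forall s t xi, uniq s -> uniq t ->
  ns s (app t a xi) <= K * ns t xi.

Definition sep (d : X -> X -> R) (r : R) s t :=
  forall x z, x \in s -> z \in t -> r < d x z.

(** Quasi-locality at one scale: the corner of [a] between finite sets more than [r] apart has
    squared norm at most [K]. No approximating operator occurs, so the condition can be asked
    uniformly over a family. *)
Definition ql (d : X -> X -> R) a (K r : R) := forall s t xi,
  uniq s -> uniq t -> sep d r s t -> ns s (app t a xi) <= K * ns t xi.

Lemma sum_mask (V : nmodType) s t (f : X -> V) : uniq s -> uniq t ->
  {subset s <= t} ->
  \sum_(x <- t) (if x \in s then f x else 0) = \sum_(x <- s) f x.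
Proof.
move=> us ut st; rewrite -big_mkcond /= -big_filter; apply: perm_big.
apply: uniq_perm => //; first exact: filter_uniq.
by move=> x; rewrite mem_filter andb_idr // => /st.
Qed.

Lemma ns_mask s t xi : uniq s -> uniq t -> {subset s <= t} ->
  ns t (fun x => if x \in s then xi x else 0) = ns s xi.
Proof.
move=> us ut st; rewrite /ns -(sum_mask _ us ut st).
by apply: eq_bigr => x _; case: ifP => // _; rewrite nn0.
Qed.

Lemma formE s a eta xi :
  Defs.form s a eta xi = \sum_(x <- s) cj (eta x) * app s a xi x.
Proof.
rewrite /Defs.form; apply: eq_bigr => x _; rewrite /app mulr_sumr.
by apply: eq_bigr => z _; rewrite mulrA.
Qed.

Lemma sqnormE s xi : sqnorm s xi = (ns s xi)%:C.
Proof.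
rewrite /sqnorm /ns rmorph_sum; apply: eq_bigr => x _; exact: normsqE.
Qed.

Lemma opnorm_le_ge0 a (M : C) : opnorm_le a M -> 0 <= M.
Proof.
move=> /(_ [::] (fun=> 0) (fun=> 0) isT).
rewrite /sqnorm /Defs.form !big_nil ler01 normr0; exact.
Qed.

Lemma opnorm_le_form a (M : R) : opnorm_le a M%:C -> forall s eta xi, uniq s ->
  nn (\sum_(x <- s) cj (eta x) * app s a xi x) <= M ^+ 2 * (ns s eta * ns s xi).
Proof.
move=> aM s eta xi us.
have M0 : 0 <= M by rewrite -ler0c; apply: opnorm_le_ge0 aM.
have [e0|e0] := leP (ns s eta) 0.
  rewrite big_seq big1 ?nn0 ?mulr_ge0 ?sqr_ge0 ?ns_ge0 // => x xs.
  by rewrite (ns_eq0 e0) // conjc0 mul0r.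
have [x0|x0] := leP (ns s xi) 0.
  rewrite big_seq big1 ?nn0 ?mulr_ge0 ?sqr_ge0 ?ns_ge0 // => x xs.
  by rewrite /app big_seq big1 ?mulr0 // => z zs; rewrite (ns_eq0 x0) // mulr0.
(* [opnorm_le] tests only vectors of the unit ball, so both are normalised; zero vectors have been
   treated apart. *)
set A := (Num.sqrt (ns s eta))^-1; set B := (Num.sqrt (ns s xi))^-1.
have A2 : A ^+ 2 * ns s eta = 1.
  by rewrite exprVn sqr_sqrtr ?ltW // mulVf // lt0r_neq0.
have B2 : B ^+ 2 * ns s xi = 1.
  by rewrite exprVn sqr_sqrtr ?ltW // mulVf // lt0r_neq0.
have nsc (D : R) f : ns s (fun x => D%:C * f x) = D ^+ 2 * ns s f.
  by rewrite /ns mulr_sumr; apply: eq_bigr => x _; rewrite nnM nn_real.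
have := aM s (fun x => A%:C * eta x) (fun x => B%:C * xi x) us.
rewrite !sqnormE !nsc A2 B2 lexx => /(_ isT isT).
rewrite norm_nn // formE.
have -> : \sum_(x <- s) cj (A%:C * eta x) * app s a (fun x => B%:C * xi x) x =
   (A * B)%:C * \sum_(x <- s) cj (eta x) * app s a xi x.
  rewrite mulr_sumr; apply: eq_bigr => x _.
  rewrite conjcM conj_real_complex real_complexM /app !mulr_sumr;
    apply: eq_bigr => z _; ring.
rewrite nnM nn_real => H.
have P0 : 0 < ns s eta * ns s xi by rewrite mulr_gt0.
rewrite -[X in _ <= X * _]mulr1 in H *.
have := ler_wpM2r (ltW P0) H.
set Z := nn _.
have -> : (A * B) ^+ 2 * Z * (ns s eta * ns s xi) =
  (A ^+ 2 * ns s eta) * (B ^+ 2 * ns s xi) * Z by ring.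
by rewrite A2 B2 !mul1r mulr1.
Qed.

(** [opnorm_le] uses one common support for both vectors; the two supports allowed by [opb] are
    merged by extending by zero to their union. *)
Lemma opnorm_le_opb a (M : R) : opnorm_le a M%:C -> opb a (M ^+ 2).
Proof.
move=> aM s t xi us ut.
apply: ns_dual => [|g]; first by rewrite mulr_ge0 ?sqr_ge0 ?ns_ge0.
set u := undup (s ++ t).
have uu : uniq u by apply: undup_uniq.
have su : {subset s <= u} by move=> x xs; rewrite mem_undup mem_cat xs.
have tu : {subset t <= u} by move=> x xs; rewrite mem_undup mem_cat xs orbT.
have := opnorm_le_form aM (fun x => if x \in s then g x else 0)
  (fun x => if x \in t then xi x else 0) uu.
rewrite !ns_mask // [ns s g * _]mulrC mulrA; apply: le_trans.
rewrite le_eqVlt; apply/orP; left; apply/eqP; congr nn.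
rewrite -(sum_mask _ us uu su); apply: eq_bigr => x _.
case: ifP => _; last by rewrite conjc0 mul0r.
congr (_ * _); rewrite /app -(sum_mask _ ut uu tu); apply: eq_bigr => z _.
by case: ifP => _; rewrite ?mulr0.
Qed.

Lemma opb_opnorm_le a (M : R) : 0 <= M -> opb a (M ^+ 2) -> opnorm_le a M%:C.
Proof.
move=> M0 aM s eta xi us; rewrite !sqnormE (lecR _ 1) (lecR _ 1) => x1 e1.
rewrite norm_nn // formE; apply: le_trans (cauchy_schwarz _ _ _) _.
have := aM s s xi us us; have := ns_ge0 s xi; have := ns_ge0 s eta.
have := ns_ge0 s (app s a xi); have := sqr_ge0 M; nra.
Qed.

Lemma bounded_matP a : bounded_mat a <-> exists2 K, 0 <= K & opb a K.
Proof.
split=> [[M aM]|[K K0 aK]].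
  have M0 := opnorm_le_ge0 aM.
  have ME : M = (complex.Re M)%:C by rewrite RRe_real // ger0_real.
  exists (complex.Re M ^+ 2); first exact: sqr_ge0.
  by apply: opnorm_le_opb; rewrite -ME.
exists (Num.sqrt K)%:C; apply: opb_opnorm_le; first exact: sqrtr_ge0.
by rewrite sqr_sqrtr.
Qed.

Definition msub a b : mat R X := fun x z => a x z - b x z.

Definition mopp a : mat R X := fun x z => - a x z.

Lemma opb_le a K L : K <= L -> opb a K -> opb a L.
Proof.
move=> KL aK s t xi us ut; apply: le_trans (aK _ _ _ us ut) _.
by apply: ler_wpM2r => //; apply: ns_ge0.
Qed.

Lemma ql_le d a K L r r' : K <= L -> r <= r' -> ql d a K r -> ql d a L r'.
Proof.
move=> KL rr aK s t xi us ut st; apply: le_trans (aK _ _ _ us ut _) _.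
  by move=> x z xs zt; apply: le_lt_trans rr _; apply: st.
by apply: ler_wpM2r => //; apply: ns_ge0.
Qed.

Lemma appD t a b xi x : app t (madd a b) xi x = app t a xi x + app t b xi x.
Proof.
rewrite /app /madd -big_split /=; apply: eq_bigr => z _; exact: mulrDl.
Qed.

Lemma appN t a xi x : app t (mopp a) xi x = - app t a xi x.
Proof. by rewrite /app -sumrN; apply: eq_bigr => z _; exact: mulNr. Qed.

Lemma opbD a b K L : opb a K -> opb b L -> opb (madd a b) (2 * K + 2 * L).
Proof.
move=> aK bL s t xi us ut.
rewrite (eq_ns (g := fun x => app t a xi x + app t b xi x)); last first.
  by move=> x _; rewrite appD.
apply: le_trans (nsD _ _ _) _.
have := aK s t xi us ut; have := bL s t xi us ut; lra.
Qed.

Lemma opbN a K : opb a K -> opb (mopp a) K.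
Proof.
move=> aK s t xi us ut.
rewrite (eq_ns (g := fun x => - app t a xi x)); last by move=> x _;
  rewrite appN.
by rewrite nsN; apply: aK.
Qed.

Lemma qlD d a b K L r : ql d a K r -> ql d b L r ->
  ql d (madd a b) (2 * K + 2 * L) r.
Proof.
move=> aK bL s t xi us ut st.
rewrite (eq_ns (g := fun x => app t a xi x + app t b xi x)); last first.
  by move=> x _; rewrite appD.
apply: le_trans (nsD _ _ _) _.
have := aK s t xi us ut st; have := bL s t xi us ut st; lra.
Qed.

Lemma qlN d a K r : ql d a K r -> ql d (mopp a) K r.
Proof.
move=> aK s t xi us ut st.
rewrite (eq_ns (g := fun x => - app t a xi x)); last by move=> x _;
  rewrite appN.
by rewrite nsN; apply: aK.
Qed.

Lemma app1 z a xi x : app [:: z] a xi x = a x z * xi z.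
Proof. by rewrite /app big_seq1. Qed.

Lemma opb_entry a K x z : opb a K -> nn (a x z) <= K.
Proof.
move=> /(_ [:: x] [:: z] (fun=> 1) isT isT).
by rewrite !ns1 app1 nn1 !mulr1.
Qed.

Lemma ql_entry d a K r x z : ql d a K r -> r < d x z -> nn (a x z) <= K.
Proof.
move=> /(_ [:: x] [:: z] (fun=> 1) isT isT) H dxz.
move: H; rewrite !ns1 app1 nn1 !mulr1; apply.
by move=> ? ?; rewrite !inE => /eqP -> /eqP ->.
Qed.

Lemma opb_col a K s z : opb a K -> uniq s -> ns s (a^~ z) <= K.
Proof.
move=> /(_ s [:: z] (fun=> 1)) H us; move: (H us isT).
by rewrite ns1 nn1 mulr1 (eq_ns (g := a^~ z)) // => x _; rewrite app1 mulr1.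
Qed.

(** Applied to the conjugate of row [x], the matrix produces the squared norm of that row as entry
    [x]; so the square of this number is at most [K] times itself. *)
Lemma opb_row a K s x : 0 <= K -> opb a K -> uniq s -> ns s (a x) <= K.
Proof.
move=> K0 /(_ [:: x] s (fun z => cj (a x z)) isT) H us; move: (H us).
have -> : ns s (fun z => cj (a x z)) = ns s (a x).
  by apply: eq_bigr => z _; rewrite nn_conj.
rewrite ns1; have -> : app s a (fun z => cj (a x z)) x = (ns s (a x))%:C.
  by rewrite /app /ns rmorph_sum; apply: eq_bigr => z _; exact: nnE.
rewrite nn_real; have := ns_ge0 s (a x).
rewrite le_eqVlt => /orP[/eqP <- //|f0].
by rewrite expr2 ler_pM2r.
Qed.

End Operators.

(** * Unconditional summation *)

Section NetSums.
Variables (R : realType) (T : eqType).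
Local Notation C := R[i].

(** The convergence by which [mmul_rel] defines each entry of a product, isolated for a single
    series. *)
Definition net_sum (f : T -> C) (l : C) := forall e : R, 0 < e ->
  exists F0 : seq T, forall F, uniq F -> {subset F0 <= F} ->
    `|\sum_(y <- F) f y - l| <= e%:C.

Lemma norm_le_real (z : C) (e : R) :
  `|complex.Re z| <= e / 2 -> `|complex.Im z| <= e / 2 -> `|z| <= e%:C.
Proof.
case: z => a b /= ae be.
have e0 : 0 <= e by have := normr_ge0 a; lra.
rewrite norm_nn // /nn /=.
move: ae be; rewrite !ler_norml => /andP[? ?] /andP[? ?]; nra.
Qed.

Lemma net_sum_ge0_real (f : T -> R) (B : R) : (forall x, 0 <= f x) ->
  (forall F, uniq F -> \sum_(x <- F) f x <= B) ->
  exists l, forall e, 0 < e -> exists F0 : seq T, forall F, uniq F ->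
    {subset F0 <= F} -> `|\sum_(y <- F) f y - l| <= e.
Proof.
move=> f0 fB.
pose S := (fun v => exists2 F, uniq F & v = \sum_(x <- F) f x) :
  classical_sets.set R.
have hS : has_sup S.
  split; first by exists 0, [::]; rewrite ?big_nil.
  by exists B => v [F uF ->]; apply: fB.
exists (sup S) => e e0.
have [v [F0 uF0 ->] Fe] := sup_adherent e0 hS.
exists F0 => F uF F0F.
have h1 : \sum_(x <- F0) f x <= \sum_(x <- F) f x by apply: ler_sum_subset.
have h2 : \sum_(x <- F) f x <= sup S by apply: sup_upper_bound => //; exists F.
rewrite ler_norml; apply/andP; split; lra.
Qed.

(** Here [f] is [(f + |f|) - |f|], a difference of two nonnegative summable families. *)
Lemma net_sum_abs_real (f : T -> R) (B : R) :
  (forall F, uniq F -> \sum_(x <- F) `|f x| <= B) ->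
  exists l, forall e, 0 < e -> exists F0 : seq T, forall F, uniq F ->
    {subset F0 <= F} -> `|\sum_(y <- F) f y - l| <= e.
Proof.
move=> fB.
have [l1 H1] := net_sum_ge0_real (fun x => normr_ge0 (f x)) fB.
have g0 x : 0 <= f x + `|f x| by have := ler_norm (- f x); rewrite normrN; lra.
have gB F : uniq F -> \sum_(x <- F) (f x + `|f x|) <= B + B.
  move=> uF; rewrite big_split /=; apply: lerD; last exact: fB.
  apply: le_trans (fB _ uF); apply: ler_sum => x _; exact: ler_norm.
have [l2 H2] := net_sum_ge0_real g0 gB.
exists (l2 - l1) => e e0; have e2 : 0 < e / 2 by lra.
have [F1 K1] := H1 _ e2; have [F2 K2] := H2 _ e2.
exists (F1 ++ F2) => F uF sF.
have {}K1 := K1 F uF ltac:(by move=> x h; apply: sF; rewrite mem_cat h).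
have {K2} := K2 F uF ltac:(by move=> x h; apply: sF; rewrite mem_cat h orbT).
rewrite big_split /=; move: K1.
rewrite !ler_norml => /andP[? ?] /andP[? ?]; apply/andP; split; lra.
Qed.

Lemma net_sum_exists (f g : T -> C) (A B : R) :
  (forall F, uniq F -> ns F f <= A) -> (forall F, uniq F -> ns F g <= B) ->
  exists l, net_sum (fun x => f x * g x) l.
Proof.
move=> fA gB.
have bnd (h : C -> R) : (forall z, `|h z| <= Num.sqrt (nn z)) ->
    forall F, uniq F -> \sum_(x <- F) `|h (f x * g x)| <= A + B.
  move=> hz F uF; apply: le_trans (lerD (fA _ uF) (gB _ uF)).
  rewrite /ns -big_split /=; apply: ler_sum => x _.
  apply: le_trans (hz _) _; rewrite nnM.
  have F0 := nn_ge0 (f x); have G0 := nn_ge0 (g x).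
  move: (nn _) (nn _) F0 G0 => p q p0 q0.
  rewrite -(ler_pXn2r (n := 2)) ?nnegrE ?sqrtr_ge0 ?addr_ge0 //.
  rewrite sqr_sqrtr ?mulr_ge0 //.
  nra.
have hR z : `|complex.Re z| <= Num.sqrt (@nn R z).
  by rewrite -sqrtr_sqr ler_sqrt ?nn_ge0 // /nn lerDl sqr_ge0.
have hI z : `|complex.Im z| <= Num.sqrt (@nn R z).
  by rewrite -sqrtr_sqr ler_sqrt ?nn_ge0 // /nn lerDr sqr_ge0.
have [lr Hr] := net_sum_abs_real (bnd _ hR).
have [li Hi] := net_sum_abs_real (bnd _ hI).
exists (lr +i* li) => e e0; have e2 : 0 < e / 2 by lra.
have [F1 K1] := Hr _ e2; have [F2 K2] := Hi _ e2.
exists (F1 ++ F2) => F uF sF; apply: norm_le_real.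
  rewrite ReD ReN Re_sum /=; apply: K1 => // x h.
  by apply: sF; rewrite mem_cat h.
rewrite ImD ImN Im_sum /=; apply: K2 => // x h.
by apply: sF; rewrite mem_cat h orbT.
Qed.

Lemma net_sum_unique (f : T -> C) l m : net_sum f l -> net_sum f m -> l = m.
Proof.
move=> fl fm; apply/eqP; rewrite -subr_eq0 -nn_eq0; apply/eqP/le_anti.
rewrite nn_ge0 andbT; apply/ler_addgt0Pr => e e0; rewrite add0r.
pose d := Num.min 1 (e / 4).
(* [d <= 1] gives [d^2 <= d <= e / 4], so the two errors [2 d^2] add up to at most [e]. *)
have d0 : 0 < d by rewrite lt_min ltr01; lra.
have d1 : d <= 1 by rewrite ge_min lexx.
have de : d <= e / 4 by rewrite ge_min lexx orbT.
have [F1 K1] := fl _ d0; have [F2 K2] := fm _ d0.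
pose F := undup (F1 ++ F2).
have h1 := K1 F (undup_uniq _) ltac:(by move=> x h;
  rewrite mem_undup mem_cat h).
have h2 := K2 F (undup_uniq _) ltac:(by move=> x h;
  rewrite mem_undup mem_cat h orbT).
rewrite !norm_nn ?(ltW d0) // in h1 h2.
have -> : l - m = (\sum_(y <- F) f y - m) + - (\sum_(y <- F) f y - l) by ring.
apply: le_trans (nnD _ _) _; rewrite nnN; nra.
Qed.

Lemma net_sumB (f g : T -> C) l m : net_sum f l -> net_sum g m ->
  net_sum (fun x => f x - g x) (l - m).
Proof.
move=> fl gm e e0; have e2 : 0 < e / 2 by lra.
have [F1 K1] := fl _ e2; have [F2 K2] := gm _ e2.
exists (F1 ++ F2) => F uF sF.
have h1 := K1 F uF ltac:(by move=> x h; apply: sF; rewrite mem_cat h).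
have h2 := K2 F uF ltac:(by move=> x h; apply: sF; rewrite mem_cat h orbT).
rewrite sumrB.
have -> : \sum_(i <- F) f i - \sum_(i <- F) g i - (l - m) =
  (\sum_(i <- F) f i - l) - (\sum_(i <- F) g i - m) by ring.
apply: le_trans (ler_normB _ _) _.
have -> : e%:C = (e / 2)%:C + (e / 2)%:C by rewrite -rmorphD /=; congr (_%:C);
  lra.
exact: lerD.
Qed.

Lemma net_sum_single (f : T -> C) y0 : (forall y, y != y0 -> f y = 0) ->
  net_sum f (f y0).
Proof.
move=> f0 e e0; exists [:: y0] => F uF sF.
have y0F : y0 \in F by apply: sF; rewrite mem_head.
rewrite (bigD1_seq y0) //= big1 ?addr0 ?subrr ?normr0; last by move=> y /f0.
by rewrite ler0c ltW.
Qed.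

Lemma Re_sum_real (f : T -> R) F :
  complex.Re (\sum_(x <- F) (f x)%:C) = \sum_(x <- F) f x.
Proof. by rewrite Re_sum. Qed.

(** Transfers a nonnegative series from complex to real numbers: its limit is real and is the
    supremum of the finite partial sums. *)
Lemma net_sum_ge0 (f : T -> R) l : (forall x, 0 <= f x) ->
  net_sum (fun x => (f x)%:C) l ->
  [/\ l = (complex.Re l)%:C, forall F, uniq F -> \sum_(x <- F) f x <=
    complex.Re l
    & forall e, 0 < e -> exists F0 : seq T, forall F, uniq F ->
      {subset F0 <= F} -> complex.Re l - e <= \sum_(x <- F) f x].
Proof.
move=> f0 fl.
have lR : exists r, l = r%:C.
  have sB F : uniq F -> \sum_(x <- F) f x <= complex.Re l.
    move=> uF; apply/ler_addgt0Pr => e e0.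
    have [F0 K] := fl _ e0.
    have := K (undup (F0 ++ F)) (undup_uniq _) ltac:(by move=> x h;
      rewrite mem_undup mem_cat h).
    rewrite norm_nn ?(ltW e0) // => /(Re_le_nn (ltW e0)).
    rewrite ReD ReN Re_sum_real ler_norml => /andP[_ h].
    have : \sum_(x <- F) f x <= \sum_(x <- undup (F0 ++ F)) f x.
      by apply: ler_sum_subset => // x h'; rewrite mem_undup mem_cat h' orbT.
    lra.
  have [r Hr] := net_sum_ge0_real f0 sB.
  exists r; apply: net_sum_unique fl _ => e e0.
  have [F0 K] := Hr _ e0; exists F0 => F uF sF.
  rewrite -rmorph_sum -rmorphB norm_nn ?(ltW e0) // nn_real.
  have := K F uF sF; rewrite ler_norml => /andP[].
  set u := _ - r => h1 h2; rewrite -/u; nra.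
case: lR => r lr; rewrite lr /=.
have K e : 0 < e -> exists F0 : seq T, forall F, uniq F -> {subset F0 <= F} ->
    `|\sum_(y <- F) f y - r| <= e.
  move=> e0; have [F0 K] := fl _ e0; exists F0 => F uF sF.
  have := K F uF sF.
  rewrite norm_nn ?(ltW e0) // => /(Re_le_nn (ltW e0)).
  by rewrite ReD ReN Re_sum_real lr.
split=> // [F uF|e e0].
  apply/ler_addgt0Pr => e e0.
  have [F0 {}K] := K _ e0.
  have := K (undup (F0 ++ F)) (undup_uniq _) ltac:(by move=> x h;
    rewrite mem_undup mem_cat h).
  have : \sum_(x <- F) f x <= \sum_(x <- undup (F0 ++ F)) f x.
    by apply: ler_sum_subset => // x h'; rewrite mem_undup mem_cat h' orbT.
  rewrite ler_norml => h1 /andP[h2 h3]; lra.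
have [F0 {}K] := K _ e0; exists F0 => F uF sF.
have := K F uF sF; rewrite ler_norml => /andP[h2 h3]; lra.
Qed.

End NetSums.

Lemma small_factor (R : realType) (d k : R) : 0 < d -> 0 <= k ->
  exists2 e, 0 < e & 2 * (e * k) <= d.
Proof.
move=> d0 k0; exists (d / (2 * (k + 1))); first by rewrite divr_gt0 //; lra.
have eE : d / (2 * (k + 1)) * (k + 1) = d / 2 by field; lra.
have e0 : 0 < d / (2 * (k + 1)) by rewrite divr_gt0 //; lra.
lra.
Qed.

(** * Products of bounded matrices *)

Section Products.
Variables (R : realType) (X : eqType).
Local Notation C := R[i].
Local Notation cj := (@conjc R).
Implicit Types (a b c : mat R X) (s t F : seq X) (xi eta : X -> C).

Lemma mmul_unique a b c c' : mmul_rel a b c -> mmul_rel a b c' -> c = c'.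
Proof.
move=> h h'; apply/funext => x; apply/funext => z.
exact: net_sum_unique (h x z) (h' x z).
Qed.

(** Rows of [a] and columns of [b] are square summable, so each entry is an absolutely convergent
    series. *)
Lemma mmul_exists a b A B : 0 <= A -> opb a A -> opb b B ->
  exists c, mmul_rel a b c.
Proof.
move=> A0 aA bB.
have H xz : exists l, net_sum (fun y => a xz.1 y * b y xz.2) l.
  apply: (net_sum_exists (A := A) (B := B)) => F uF.
    exact: opb_row aA uF.
  exact: opb_col bB uF.
have [c Hc] := choice H.
by exists (fun x z => c (x, z)) => x z; apply: (Hc (x, z)).
Qed.

Lemma finite_eventually (I : eqType) (P : I -> seq X -> Prop) (l : seq I) :
  (forall i, i \in l -> exists F0 : seq X, forall F, uniq F ->
     {subset F0 <= F} -> P i F) ->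
  exists F0 : seq X, forall F, uniq F -> {subset F0 <= F} ->
     forall i, i \in l -> P i F.
Proof.
elim: l => [|i l IH] H; first by exists [::].
have [F1 K1] := H i (mem_head _ _).
have [F2 K2] := IH (fun j jl => H j ltac:(by rewrite inE jl orbT)).
exists (F1 ++ F2) => F uF sF j; rewrite inE => /orP[/eqP ->|jl].
  by apply: K1 => // x h; apply: sF; rewrite mem_cat h.
by apply: K2 => // x h; apply: sF; rewrite mem_cat h orbT.
Qed.

Lemma app_app F t a b xi x :
  app F a (app t b xi) x = \sum_(z <- t) (\sum_(y <- F) a x y * b y z) * xi z.
Proof.
under [RHS]eq_bigr do rewrite mulr_suml.
rewrite [RHS]exchange_big /=; apply: eq_bigr => y _.
by rewrite /app mulr_sumr; apply: eq_bigr => z _; rewrite mulrA.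
Qed.

Lemma mmul_uniform a b c s t e : mmul_rel a b c -> 0 < e ->
  exists F0 : seq X, forall F, uniq F -> {subset F0 <= F} ->
  forall x z, x \in s -> z \in t ->
  nn (\sum_(y <- F) a x y * b y z - c x z) <= e ^+ 2.
Proof.
move=> abc e0.
have [F0 HF0] : exists F0 : seq X, forall F, uniq F -> {subset F0 <= F} ->
    forall i, i \in [seq (x, z) | x <- s, z <- t] ->
    `|\sum_(y <- F) a i.1 y * b y i.2 - c i.1 i.2| <= e%:C.
  apply: (finite_eventually (P := fun i F =>
    `|\sum_(y <- F) a i.1 y * b y i.2 - c i.1 i.2| <= e%:C)) => i _.
  exact: abc.
exists F0 => F uF sF x z xs zt.
by have := HF0 F uF sF (x, z) (allpairs_f pair xs zt);
  rewrite norm_nn ?(ltW e0).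
Qed.

Lemma small_form_le (D : mat R X) s t eta xi e : 0 < e ->
  (forall x z, x \in s -> z \in t -> nn (D x z) <= e ^+ 2) ->
  `|complex.Re (\sum_(x <- s) cj (eta x) * app t D xi x)| <=
  e * \sum_(x <- s) \sum_(z <- t) (nn (eta x) + nn (xi z)).
Proof.
move=> e0 De; rewrite Re_sum mulr_sumr.
apply: le_trans (ler_norm_sum _ _ _) _.
rewrite big_seq [X in _ <= X]big_seq; apply: ler_sum => x xs.
rewrite /app mulr_sumr Re_sum mulr_sumr.
apply: le_trans (ler_norm_sum _ _ _) _.
rewrite big_seq [X in _ <= X]big_seq; apply: ler_sum => z zt.
have p0 := nn_ge0 (eta x); have q0 := nn_ge0 (xi z).
apply: Re_le_nn; first exact: mulr_ge0 (ltW e0) (addr_ge0 p0 q0).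
rewrite !nnM nn_conj; have := De x z xs zt.
move: (nn (eta x)) (nn (xi z)) (nn (D x z)) p0 q0 (nn_ge0 (D x z)).
move=> p q r p0 q0 r0 re.
have -> : p * (r * q) = r * (p * q) by ring.
rewrite exprMn; apply: ler_pM => //; first exact: mulr_ge0.
nra.
Qed.

Lemma app_app_msub F t a b c xi x : app F a (app t b xi) x = app t c xi x +
  app t (fun x z => \sum_(y <- F) a x y * b y z - c x z) xi x.
Proof.
rewrite app_app /app -big_split /=; apply: eq_bigr => z _; ring.
Qed.

(** Products are only entrywise limits of the truncations [a 1_F b]; this passes norm bounds to the
    limit. Pairing with [eta = c xi] gives [|eta|^2 <= (|eta|^2 + Q) / 2] up to an error that
    entrywise closeness on the finite sets [s], [t] makes arbitrarily small. *)
Lemma mmul_limit a b c s t xi (Q : R) (F1 : seq X) : mmul_rel a b c ->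
  (forall F, uniq F -> {subset F1 <= F} -> ns s (app F a (app t b xi)) <= Q) ->
  ns s (app t c xi) <= Q.
Proof.
move=> abc HQ; set eta := app t c xi.
pose C0 := \sum_(x <- s) \sum_(z <- t) (nn (eta x) + nn (xi z)).
have C00 : 0 <= C0.
  by apply: sumr_ge0 => x _; apply: sumr_ge0 => z _; rewrite addr_ge0 ?nn_ge0.
apply/ler_addgt0Pr => d d0.
have [e e0 eC] := small_factor d0 C00.
have [F0 HF0] := mmul_uniform s t abc e0.
pose F := undup (F0 ++ F1).
have uF : uniq F by apply: undup_uniq.
have {}HQ := HQ F uF ltac:(by move=> x h; rewrite mem_undup mem_cat h orbT).
have {HF0} HF := HF0 F uF ltac:(by move=> x h; rewrite mem_undup mem_cat h).
have h1 := ip_le s eta (app F a (app t b xi)).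
have h2 : \sum_(x <- s) cj (eta x) * app F a (app t b xi) x = (ns s eta)%:C +
    \sum_(x <- s) cj (eta x) *
      app t (fun x z => \sum_(y <- F) a x y * b y z - c x z) xi x.
  rewrite -ip_self -big_split /=; apply: eq_bigr => x _.
  by rewrite -mulrDr -app_app_msub.
have := small_form_le eta xi e0 HF; rewrite -/C0 ler_norml => /andP[h3 _].
move: h1; rewrite h2 ReD /=; lra.
Qed.

Lemma opb_mul a b c A B : 0 <= A -> opb a A -> opb b B -> mmul_rel a b c ->
  opb c (A * B).
Proof.
move=> A0 aA bB abc s t xi us ut.
apply: (mmul_limit (F1 := [::]) abc) => F uF _.
apply: le_trans (aA _ _ _ us uF) _; rewrite -mulrA; apply: ler_wpM2l => //.
exact: bB.
Qed.

Lemma app_cat F (p : pred X) a xi x :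
  app F a xi x = app (filter p F) a xi x + app (filter (predC p) F) a xi x.
Proof.
rewrite /app !big_filter; elim: F => [|y F IH]; first by rewrite !big_nil addr0.
by rewrite !big_cons IH /=; case: (p y) => /=; ring.
Qed.

(** An intermediate point is either more than [r] away from all of [s], where [a] is small, or
    within [r] of a point of [s], hence more than [r'] away from [t], where [b] is small. *)
Lemma ql_mul d a b c A B K L r r' : is_metric d -> 0 <= A -> 0 <= K ->
  opb a A -> opb b B -> ql d a K r -> ql d b L r' -> mmul_rel a b c ->
  ql d c (2 * (K * B) + 2 * (A * L)) (r + r').
Proof.
move=> [_ [_ [_ tri]]] A0 K0 aA bB aK bL abc s t xi us ut st.
apply: (mmul_limit (F1 := [::]) abc) => F uF _.
pose far y := all (fun x => r < d x y) s.
set be := app t b xi.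
rewrite (eq_ns (g := fun x => app (filter far F) a be x +
  app (filter (predC far) F) a be x)); last by move=> x _; exact: app_cat.
apply: le_trans (nsD _ _ _) _.
have u1 : uniq (filter far F) by apply: filter_uniq.
have u2 : uniq (filter (predC far) F) by apply: filter_uniq.
have h1 : ns s (app (filter far F) a be) <= K * ns (filter far F) be.
  apply: aK => // x y xs; rewrite mem_filter => /andP[/allP yf _].
  exact: yf.
have h2 := aA s (filter (predC far) F) be us u2.
have h3 := bB _ t xi u1 ut.
have h4 : ns (filter (predC far) F) be <= L * ns t xi.
  apply: bL => // y z; rewrite mem_filter => /andP[/allPn[x xs]].
  rewrite -leNgt => dxy _ zt; have := st x z xs zt; have := tri x y z; lra.
have h5 := ler_wpM2l K0 h3; have h6 := ler_wpM2l A0 h4.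
rewrite -/be in h5; lra.
Qed.

Lemma mmulBr a b b' c c' : mmul_rel a b c -> mmul_rel a b' c' ->
  mmul_rel a (msub b b') (msub c c').
Proof.
move=> h h' x z; have := net_sumB (h x z) (h' x z).
move=> H e e0; have [F0 K] := H e e0; exists F0 => F uF sF.
have := K F uF sF; congr (`|_ - _| <= _); apply: eq_bigr => y _.
by rewrite mulrBr.
Qed.

Lemma mmulBl a a' b c c' : mmul_rel a b c -> mmul_rel a' b c' ->
  mmul_rel (msub a a') b (msub c c').
Proof.
move=> h h' x z; have := net_sumB (h x z) (h' x z).
move=> H e e0; have [F0 K] := H e e0; exists F0 => F uF sF.
have := K F uF sF; congr (`|_ - _| <= _); apply: eq_bigr => y _.
by rewrite mulrBl.
Qed.

(* [|| q xi ||^2 = <xi, q xi> <= (|| xi ||^2 + || q xi ||^2) / 2]. *)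
Lemma opb_contraction (q : mat R X) : madj q = q -> mmul_rel q q q -> opb q 1.
Proof.
move=> qa qq s t xi us ut; rewrite mul1r.
set be := app t q xi.
apply/ler_addgt0Pr => d d0.
pose C0 := \sum_(x <- t) \sum_(z <- t) (nn (xi x) + nn (xi z)).
have C00 : 0 <= C0.
  by apply: sumr_ge0 => x _; apply: sumr_ge0 => z _; rewrite addr_ge0 ?nn_ge0.
have [e e0 eC] := small_factor d0 C00.
have [F0 HF0] := mmul_uniform t t qq e0.
pose F := undup (F0 ++ s ++ t).
have uF : uniq F by apply: undup_uniq.
have sF : {subset s <= F} by move=> x h; rewrite mem_undup !mem_cat h orbT.
have tF : {subset t <= F} by move=> x h; rewrite mem_undup !mem_cat h !orbT.
have {HF0} HF := HF0 F uF ltac:(by move=> x h; rewrite mem_undup mem_cat h).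
(* Up to the error of truncating [q q], this is [<xi, q xi> = |q xi|^2], the norm being taken over
   [F]. *)
have hF : \sum_(x <- t) cj (xi x) * be x + \sum_(x <- t) cj (xi x) *
    app t (fun x z => \sum_(y <- F) q x y * q y z - q x z) xi x = (ns F be)%:C.
  rewrite -ip_self -big_split /=.
  transitivity (\sum_(x <- t) cj (xi x) * app F q be x).
    by apply: eq_bigr => x _; rewrite -mulrDr -app_app_msub.
  rewrite /app; under [LHS]eq_bigr do rewrite mulr_sumr.
  rewrite [LHS]exchange_big /=; apply: eq_bigr => y _.
  have -> : cj (be y) = \sum_(x <- t) cj (xi x) * q x y.
    rewrite conjc_sum; apply: eq_bigr => x _.
    by rewrite conjcM mulrC -[in RHS]qa.
  by rewrite mulr_suml; apply: eq_bigr => x _; rewrite mulrA.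
clear qa.
have := small_form_le xi xi e0 HF; rewrite -/C0 ler_norml => /andP[_ h3].
have h1 := ip_le t xi be.
have h4 := congr1 (@complex.Re R) hF; rewrite ReD /= in h4.
have h5 := ns_subset be us sF; have h6 := ns_subset be ut tF.
lra.
Qed.

End Products.

(** * Membership in the uniform Roe algebra *)

Section UniformRoe.
Variables (R : realType) (X : eqType) (d : X -> X -> R).
Local Notation C := R[i].
Local Notation cj := (@conjc R).
Implicit Types (a b c : mat R X) (s t F : seq X) (xi eta : X -> C).

Lemma uroe_opb a : uroe d a -> exists2 K, 0 <= K & opb a K.
Proof. by case=> /bounded_matP. Qed.

Lemma uroe_approx a e : uroe d a -> 0 < e ->
  exists2 b, finite_propagation d b & opb (msub a b) e.
Proof.
move=> [_ H] e0; have s0 : 0 < Num.sqrt e by rewrite sqrtr_gt0.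
have [b [fb ab]] := H _ s0; exists b => //.
by rewrite -(sqr_sqrtr (ltW e0)); apply: opnorm_le_opb.
Qed.

Lemma uroeP a : (exists2 K, 0 <= K & opb a K) ->
  (forall e, 0 < e -> exists2 b, finite_propagation d b & opb (msub a b) e) ->
  uroe d a.
Proof.
move=> aK H; split; first exact/bounded_matP.
move=> e e0; have e2 : 0 < e ^+ 2 by rewrite exprn_gt0.
have [b fb ab] := H _ e2; exists b; split => //.
by apply: opb_opnorm_le => //; apply: ltW.
Qed.

(** A finite propagation approximant has no entries between sets farther apart than its propagation,
    so only the approximation error remains there. *)
Lemma uroe_ql a K : uroe d a -> 0 < K -> exists r, ql d a K r.
Proof.
move=> ua K0; have [b [[r br] _] ab] := uroe_approx ua K0.
exists r => s t xi us ut st.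
rewrite (eq_ns (g := app t (msub a b) xi)); first exact: ab.
move=> x xs; rewrite /app big_seq [RHS]big_seq; apply: eq_bigr => z zt.
rewrite /msub; have -> : b x z = 0; last by rewrite subr0.
apply/eqP; apply: contraT => /br; have := st x z xs zt; lra.
Qed.

Lemma finite_propagation_mul a b c A B : is_metric d -> 0 <= A ->
  opb a A -> opb b B -> mmul_rel a b c ->
  finite_propagation d a -> finite_propagation d b -> finite_propagation d c.
Proof.
move=> [_ [_ [_ tri]]] A0 aA bB abc [[r ar] _] [[r' br] _]; split.
  exists (r + r') => x z; apply: contraNT; rewrite -ltNge => dxz.
  apply/eqP; apply: net_sum_unique (abc x z) _.
  have f0 y : a x y * b y z = 0.
    apply/eqP; apply: contraT; rewrite mulf_eq0 negb_or => /andP[/ar h1 /br h2].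
    have := tri x y z; lra.
  by rewrite -(f0 x); apply: net_sum_single => y _; rewrite f0.
have cAB := opb_mul A0 aA bB abc.
exists (1 + A * B) => x z; have := opb_entry x z cAB.
have n0 := nn_ge0 (c x z).
move=> h; rewrite norm_nn; nra.
Qed.

(** [ab - a'b' = a(b - b') + (a - a')b'] for finite propagation approximants [a'], [b']. *)
Lemma uroe_mul a b c : is_metric d -> uroe d a -> uroe d b ->
  mmul_rel a b c -> uroe d c.
Proof.
move=> md ua ub abc.
have [A A0 aA] := uroe_opb ua; have [B B0 bB] := uroe_opb ub.
apply: uroeP; first by exists (A * B); [exact: mulr_ge0 | exact: opb_mul abc].
move=> e e0.
pose g := e / (4 * (A + 1)).
have g0 : 0 < g by rewrite divr_gt0 //; lra.
have [b' fb' bb'] := uroe_approx ub g0.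
pose B' := 2 * B + 2 * g.
have B'0 : 0 <= B' by rewrite /B'; lra.
have bB' : opb b' B'.
  have -> : b' = madd b (mopp (msub b b')).
    by apply/funext => x; apply/funext => z; rewrite /madd /mopp /msub; ring.
  by apply: opbD => //; apply: opbN.
(* The bound [B'] on [b'] is known only now, so [a] is approximated after [b]; each of the two
   errors contributes at most [e / 2]. *)
pose h := e / (4 * (B' + 1)).
have h0 : 0 < h by rewrite divr_gt0 //; lra.
have [a' fa' aa'] := uroe_approx ua h0.
pose A' := 2 * A + 2 * h.
have A'0 : 0 <= A' by rewrite /A'; lra.
have aA' : opb a' A'.
  have -> : a' = madd a (mopp (msub a a')).
    by apply/funext => x; apply/funext => z; rewrite /madd /mopp /msub; ring.
  by apply: opbD => //; apply: opbN.
have [c1 abc1] := mmul_exists A0 aA bB'.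
have [c2 abc2] := mmul_exists A'0 aA' bB'.
exists c2; first exact: (finite_propagation_mul md A'0 aA' bB' abc2 fa' fb').
have -> : msub c c2 = madd (msub c c1) (msub c1 c2).
  by apply/funext => x; apply/funext => z; rewrite /madd /msub; ring.
have k1 := opb_mul A0 aA bb' (mmulBr abc abc1).
have k2 := opb_mul (ltW h0) aa' bB' (mmulBl abc1 abc2).
apply: opb_le (opbD k1 k2).
have gE : (A + 1) * g = e / 4 by rewrite /g; field; lra.
have hE : h * (B' + 1) = e / 4 by rewrite /h; field; lra.
nra.
Qed.

Lemma uroe_mul_exists a b : is_metric d -> uroe d a -> uroe d b ->
  exists2 c, uroe d c & mmul_rel a b c.
Proof.
move=> md ua ub; have [A A0 aA] := uroe_opb ua; have [B B0 bB] := uroe_opb ub.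
have [c abc] := mmul_exists A0 aA bB.
by exists c => //; apply: uroe_mul abc.
Qed.

(** Schur test: a row has at most [N] nonzero entries, which by Cauchy-Schwarz costs [N * M^2], and
    each column index is met by at most [N] rows, which costs the other [N]. *)
Lemma finite_propagation_uroe b : is_metric d -> ulf d ->
  finite_propagation d b -> uroe d b.
Proof.
move=> [_ [_ [dC _]]] ud fb; apply: uroeP; last first.
  move=> e e0; exists b => // s t xi us ut.
  rewrite (eq_ns (g := fun=> 0)); last first.
    by move=> x _; rewrite /app big1 // => z _; rewrite /msub subrr mul0r.
  by rewrite /ns big1 ?mulr_ge0 ?ns_ge0 ?(ltW e0) // => x _; rewrite nn0.
case: fb => [[r0 br0] [M bM]].
(* [ulf] speaks of positive radii, while [r0] is arbitrary. *)
pose r := `|r0| + 1.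
have rp : 0 < r by rewrite /r; have := normr_ge0 r0; lra.
have br x z : b x z != 0 -> d x z <= r.
  by move=> /br0 h; apply: le_trans h _; rewrite /r; have := ler_norm r0; lra.
have [N HN] := ud r rp.
exists (N%:R * M ^+ 2 * N%:R).
  by apply: mulr_ge0 => //; apply: mulr_ge0 => //; apply: sqr_ge0.
move=> s t xi us ut.
have M2 x z : nn (b x z) <= M ^+ 2.
  have h := bM x z; have M0 : 0 <= M by rewrite -ler0c; apply: le_trans h.
  by rewrite -norm_nn.
have h1 x : nn (app t b xi x) <=
    N%:R * M ^+ 2 * \sum_(z <- t | d x z <= r) nn (xi z).
  have -> : app t b xi x = \sum_(z <- [seq z <- t | d x z <= r]) cj (cj (b x
    z)) * xi z.
    rewrite big_filter big_mkcond /=; apply: eq_bigr => z _.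
    case: ifPn => [_|dz]; first by rewrite conjcK.
    have -> : b x z = 0 by apply/eqP; apply: contraNT dz => /br.
    by rewrite mul0r.
  apply: le_trans (cauchy_schwarz _ _ _) _.
  rewrite -big_filter -/(ns _ xi); apply: ler_wpM2r; first exact: ns_ge0.
  rewrite /ns; under eq_bigr do rewrite nn_conj.
  have := HN x [seq z <- t | d x z <= r] (filter_uniq _ ut)
    ltac:(by move=> y; rewrite mem_filter => /andP[]).
  set t' := filter _ _ => sz.
  apply: (@le_trans _ _ (\sum_(z <- t') M ^+ 2)); first exact: ler_sum.
  rewrite big_const_seq count_predT iter_addr_0 -[X in X <= _]mulr_natl.
  by apply: ler_wpM2r; rewrite ?sqr_ge0 // ler_nat.
apply: (@le_trans _ _ (\sum_(x <- s) N%:R * M ^+ 2 *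
    \sum_(z <- t | d x z <= r) nn (xi z))); first exact: ler_sum.
rewrite -mulr_sumr -[X in _ <= X]mulrA; apply: ler_wpM2l.
  by rewrite mulr_ge0 ?sqr_ge0.
under eq_bigr do rewrite big_mkcond.
rewrite exchange_big /= /ns mulr_sumr; apply: ler_sum => z _.
rewrite -big_mkcond /= -big_filter big_const_seq count_predT iter_addr_0.
rewrite -[X in X <= _]mulr_natl; apply: ler_wpM2r; first exact: nn_ge0.
rewrite ler_nat; apply: (HN z); first exact: filter_uniq.
by move=> x; rewrite mem_filter dC => /andP[].
Qed.

End UniformRoe.

(** * Algebra operations, matrix units and diagonal projections *)

Section UniformRoeAlgebra.
Variables (R : realType) (X : eqType) (d : X -> X -> R).
Local Notation C := R[i].
Local Notation cj := (@conjc R).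
Implicit Types (a b c : mat R X) (s t F : seq X) (xi eta : X -> C).

Lemma opbZ (l : C) a K : opb a K -> opb (mscale l a) (nn l * K).
Proof.
move=> aK s t xi us ut.
rewrite (eq_ns (g := fun x => app t a xi x * l)); last first.
  by move=> x _; rewrite /app mulr_suml; apply: eq_bigr => z _;
    rewrite /mscale; ring.
rewrite nsZ [_ * nn l]mulrC -mulrA; apply: ler_wpM2l; first exact: nn_ge0.
exact: aK.
Qed.

Lemma opb_adj a K : 0 <= K -> opb a K -> opb (madj a) K.
Proof.
move=> K0 aK s t xi us ut; apply: ns_dual => [|g].
  by apply: mulr_ge0 => //; apply: ns_ge0.
have -> : \sum_(x <- s) cj (g x) * app t (madj a) xi x =
    cj (\sum_(z <- t) cj (xi z) * app s a g z).
  rewrite conjc_sum /app; under eq_bigr do rewrite mulr_sumr.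
  rewrite exchange_big /=; apply: eq_bigr => z _.
  rewrite conjcM conjcK conjc_sum mulr_sumr; apply: eq_bigr => x _.
  by rewrite conjcM /madj; ring.
rewrite nn_conj; apply: le_trans (cauchy_schwarz _ _ _) _.
rewrite [K * _]mulrC -mulrA; apply: ler_wpM2l; first exact: ns_ge0.
exact: aK.
Qed.

Lemma normC_add_le (z w : C) (A B : R) :
  `|z| <= A%:C -> `|w| <= B%:C -> `|z + w| <= (A + B)%:C.
Proof.
move=> zA wB; apply: le_trans (ler_normD _ _) _.
by rewrite rmorphD /=; apply: lerD.
Qed.

Lemma uroe_add a b : uroe d a -> uroe d b -> uroe d (madd a b).
Proof.
move=> ua ub; have [A A0 aA] := uroe_opb ua; have [B B0 bB] := uroe_opb ub.
apply: uroeP => [|e e0].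
  by exists (2 * A + 2 * B); [lra | apply: opbD].
have e4 : 0 < e / 4 by lra.
have [a' [[r ar] [M aM]] aa] := uroe_approx ua e4.
have [b' [[r' br] [M' bM]] bb] := uroe_approx ub e4.
exists (madd a' b').
  split; last by exists (M + M') => x z; apply: normC_add_le.
  exists (`|r| + `|r'|) => x z nz.
  have := ler_norm r; have := ler_norm r'.
  have := normr_ge0 r; have := normr_ge0 r'.
  have [az|/ar ?] := eqVneq (a' x z) 0; last by lra.
  have [bz|/br ?] := eqVneq (b' x z) 0; last by lra.
  by rewrite /madd az bz addr0 eqxx in nz.
have -> : msub (madd a b) (madd a' b') = madd (msub a a') (msub b b').
  by apply/funext => x; apply/funext => z; rewrite /madd /msub; ring.
by apply: opb_le (opbD aa bb); lra.
Qed.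

Lemma uroe_scale l a : uroe d a -> uroe d (mscale l a).
Proof.
move=> ua; have [A A0 aA] := uroe_opb ua; have l0 := nn_ge0 l.
apply: uroeP => [|e e0].
  by exists (nn l * A); [exact: mulr_ge0 | apply: opbZ].
have [g g0 gl] := small_factor e0 l0.
have [a' [[r ar] [M aM]] aa] := uroe_approx ua g0.
exists (mscale l a').
  split.
    by exists r => x z; rewrite /mscale mulf_eq0 negb_or => /andP[_ /ar].
  (* [|l| <= |l|^2 + 1] gives an entry bound without a square root. *)
  exists ((nn l + 1) * M) => x z.
  have M0 : 0 <= M by have := aM x z; rewrite -ler0c; apply: le_trans.
  have := aM x z; rewrite !norm_nn //; last exact: mulr_ge0 (addr_ge0 l0 ler01)
    M0.
  rewrite nnM exprMn => h; apply: ler_pM => //; [exact: nn_ge0|].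
  have := sqr_ge0 (nn l); nra.
have -> : msub (mscale l a) (mscale l a') = mscale l (msub a a').
  by apply/funext => x; apply/funext => z; rewrite /mscale /msub; ring.
by apply: opb_le (opbZ l aa); nra.
Qed.

Lemma uroe_adj a : is_metric d -> uroe d a -> uroe d (madj a).
Proof.
move=> [_ [_ [dC _]]] ua; have [A A0 aA] := uroe_opb ua.
apply: uroeP => [|e e0]; first by exists A => //; apply: opb_adj.
have [a' [[r ar] [M aM]] aa] := uroe_approx ua e0.
exists (madj a').
  split; first by exists r => x z; rewrite /madj conjc_eq0 dC => /ar.
  exists M => x z.
  have M0 : 0 <= M by have := aM x z; rewrite -ler0c; apply: le_trans.
  by rewrite norm_nn // /madj nn_conj -norm_nn.
have -> : msub (madj a) (madj a') = madj (msub a a').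
  by apply/funext => x; apply/funext => z; rewrite /madj /msub rmorphB.
by apply: opb_adj => //; apply: ltW.
Qed.

Definition emx (y y' : X) : mat R X := fun u w => ((u == y) && (w == y'))%:R.

Definition chi (S : pred X) : mat R X := fun u w => ((u == w) && S u)%:R.

Definition nbr (r : R) : mat R X := fun u w => (d u w <= r)%R%:R.

Lemma norm_bool_le1 (b : bool) : `|b%:R : C| <= 1%:C.
Proof. by case: b; rewrite ?normr1 ?normr0 ?ler01. Qed.

Lemma bool_neq0 (b : bool) : (b%:R : C) != 0 -> b.
Proof. by case: b; rewrite ?eqxx. Qed.

Hypotheses (md : is_metric d) (ud : ulf d).

Lemma uroe_emx y y' : uroe d (emx y y').
Proof.
apply: finite_propagation_uroe => //; split; last first.
  by exists 1 => *; apply: norm_bool_le1.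
by exists (d y y') => x z /bool_neq0 /andP[/eqP -> /eqP ->].
Qed.

Lemma uroe_chi S : uroe d (chi S).
Proof.
apply: finite_propagation_uroe => //; split; last first.
  by exists 1 => *; apply: norm_bool_le1.
by exists 0 => x z /bool_neq0 /andP[/eqP -> _]; case: md => ->.
Qed.

Lemma uroe_nbr r : uroe d (nbr r).
Proof.
apply: finite_propagation_uroe => //; split; last first.
  by exists 1 => *; apply: norm_bool_le1.
by exists r => x z /bool_neq0.
Qed.

Lemma mmul_emx_l y y' a :
  mmul_rel (emx y y') a (fun u w => (u == y)%:R * a y' w).
Proof.
move=> u w.
have -> : (u == y)%:R * a y' w = emx y y' u y' * a y' w by rewrite /emx eqxx
  andbT.
apply: (net_sum_single (f := fun v => emx y y' u v * a v w)) => v vy.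
by rewrite /emx (negbTE vy) andbF mul0r.
Qed.

Lemma mmul_emx_r y y' a :
  mmul_rel a (emx y y') (fun u w => a u y * (w == y')%:R).
Proof.
move=> u w.
have -> : a u y * (w == y')%:R = a u y * emx y y' y w by rewrite /emx eqxx.
apply: (net_sum_single (f := fun v => a u v * emx y y' v w)) => v vy.
by rewrite /emx (negbTE vy) /= mulr0.
Qed.

Lemma mmul_chi_l S a : mmul_rel (chi S) a (fun u w => (S u)%:R * a u w).
Proof.
move=> u w.
have -> : (S u)%:R * a u w = chi S u u * a u w by rewrite /chi eqxx.
apply: (net_sum_single (f := fun v => chi S u v * a v w)) => v vy.
by rewrite /chi eq_sym (negbTE vy) mul0r.
Qed.

Lemma mmul_chi S S' : mmul_rel (chi S) (chi S') (chi (fun x => S x && S' x)).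
Proof.
have -> : chi (fun x => S x && S' x) = fun u w => (S u)%:R * chi S' u w.
  apply/funext => u; apply/funext => w; rewrite /chi /=.
  by case: (u == w); case: (S u); case: (S' u); rewrite /= ?mulr0 ?mul0r ?mulr1.
exact: mmul_chi_l.
Qed.

Lemma madj_chi S : madj (chi S) = chi S.
Proof.
apply/funext => u; apply/funext => w; rewrite /madj /chi conjc_nat eq_sym.
by case: eqP => // ->.
Qed.

Lemma madj_emx y y' : madj (emx y y') = emx y' y.
Proof.
by apply/funext => u; apply/funext => w; rewrite /madj /emx conjc_nat andbC.
Qed.

Lemma emx_chi y : emx y y = chi (pred1 y).
Proof.
apply/funext => u; apply/funext => w; rewrite /emx /chi /=.
by case: (eqVneq u y) => [->|_]; rewrite ?andbF // andbT eq_sym.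
Qed.

Lemma chi_add S S' : (forall x, ~~ (S x && S' x)) ->
  madd (chi S) (chi S') = chi (fun x => S x || S' x).
Proof.
move=> H; apply/funext => u; apply/funext => w; rewrite /madd /chi /=.
have := H u; case: (u == w); case: (S u); case: (S' u) => //=;
  by rewrite ?addr0 ?add0r.
Qed.

End UniformRoeAlgebra.

Arguments emx {R X}.
Arguments chi {R X}.

(** * Isomorphisms and the images of rank one projections *)

Section IsomorphismPairs.
Variable R : realType.
Local Notation C := R[i].
Local Notation cj := (@conjc R).

(** Carrying the inverse along makes the data symmetric: every statement about [psi] yields the dual
    one about [phi]. The maps are mutually inverse only on the algebras, their values elsewhere
    being arbitrary. *)
Definition iso_pair (X Y : eqType) (dX : X -> X -> R) (dY : Y -> Y -> R)
    (phi : mat R X -> mat R Y) (psi : mat R Y -> mat R X) :=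
  [/\ star_iso dX dY phi, star_iso dY dX psi,
    forall c, uroe dY c -> phi (psi c) = c
    & forall a, uroe dX a -> psi (phi a) = a].

Lemma iso_pair_sym (X Y : eqType) (dX : X -> X -> R) (dY : Y -> Y -> R) phi psi
  :
  iso_pair dX dY phi psi -> iso_pair dY dX psi phi.
Proof. by case. Qed.

Lemma star_iso_pair (X Y : eqType) (dX : X -> X -> R) (dY : Y -> Y -> R) phi :
  is_metric dX -> is_metric dY -> star_iso dX dY phi ->
  exists psi, iso_pair dX dY phi psi.
Proof.
move=> mX mY iso; have [f1 [f2 [f3 [f4 [f5 [f6 f7]]]]]] := iso.
have H c : exists a, uroe dY c -> uroe dX a /\ phi a = c.
  have [uc|nc] := pselect (uroe dY c); last by exists (fun _ _ => 0).
  by have [a ua ac] := f3 c uc; exists a.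
have [psi Hpsi] := choice H.
have uP c : uroe dY c -> uroe dX (psi c) by move=> /Hpsi[].
have fP c : uroe dY c -> phi (psi c) = c by move=> /Hpsi[].
have Pf a : uroe dX a -> psi (phi a) = a.
  by move=> ua; apply: f2 => //; [apply: uP; apply: f1 | apply: fP; apply: f1].
exists psi; split => //; split=> //; split.
  by move=> a b ua ub ab; rewrite -(fP a ua) -(fP b ub) ab.
split; first by move=> c uc; exists (phi c); [exact: f1 | exact: Pf].
split.
  move=> a b ua ub; apply: f2.
  - by apply: uP; apply: uroe_add.
  - by apply: uroe_add; apply: uP.
  by rewrite f4 ?fP //; [apply: uroe_add | apply: uP | apply: uP].
split.
  move=> l a ua; apply: f2.
  - by apply: uP; apply: uroe_scale.
  - by apply: uroe_scale; apply: uP.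
  by rewrite f5 ?fP //; [apply: uroe_scale | apply: uP].
split.
  move=> a ua; apply: f2.
  - by apply: uP; apply: uroe_adj.
  - by apply: uroe_adj => //; apply: uP.
  by rewrite f6 ?fP //; [apply: uroe_adj | apply: uP].
move=> a b c ua ub uc abc.
(* The product clause for [phi] only goes forward: the product of [psi a] and [psi b] is formed in
   the algebra of [X], pushed through [phi], and identified with [c] by uniqueness. *)
have [e ue abe] := uroe_mul_exists mX (uP a ua) (uP b ub).
have := f7 _ _ _ (uP a ua) (uP b ub) ue abe.
by rewrite !fP // => /(mmul_unique abc) ->; rewrite Pf.
Qed.

Section Pair.
Variables (X Y : eqType) (dX : X -> X -> R) (dY : Y -> Y -> R).
Variables (phi : mat R X -> mat R Y) (psi : mat R Y -> mat R X).
Hypotheses (mX : is_metric dX) (mY : is_metric dY) (uX : ulf dX) (uY : ulf dY).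
Hypothesis H : iso_pair dX dY phi psi.

Lemma psi_uroe c : uroe dY c -> uroe dX (psi c).
Proof. by case: H => _ [h _] _ _; apply: h. Qed.

Lemma phi_uroe a : uroe dX a -> uroe dY (phi a).
Proof. by case: H => [[h _]] _ _ _; apply: h. Qed.

Lemma psi_add a b : uroe dY a -> uroe dY b ->
  psi (madd a b) = madd (psi a) (psi b).
Proof. by case: H => _ [_ [_ [_ [h _]]]] _ _; apply: h. Qed.

Lemma psi_scale l a : uroe dY a -> psi (mscale l a) = mscale l (psi a).
Proof. by case: H => _ [_ [_ [_ [_ [h _]]]]] _ _; apply: h. Qed.

Lemma psi_adj a : uroe dY a -> psi (madj a) = madj (psi a).
Proof. by case: H => _ [_ [_ [_ [_ [_ [h _]]]]]] _ _; apply: h. Qed.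

Lemma psi_mul a b c : uroe dY a -> uroe dY b -> uroe dY c ->
  mmul_rel a b c -> mmul_rel (psi a) (psi b) (psi c).
Proof. by case: H => _ [_ [_ [_ [_ [_ [_ h]]]]]] _ _; apply: h. Qed.

Lemma psiK a : uroe dX a -> psi (phi a) = a.
Proof. by case: H => _ _ _ h; apply: h. Qed.

Lemma psi_inj a b : uroe dY a -> uroe dY b -> psi a = psi b -> a = b.
Proof. by case: H => _ [_ [h _]] _ _; apply: h. Qed.

(* Minimality of the projections [emx y y]: [e_{y y'} m e_{y2 y3}] is a multiple
   of [e_{y y3}], the multiple being an entry of [m]. *)
Lemma sandwich y y' y2 y3 a b x z :
  psi (emx y y') x a * psi (emx y2 y3) b z =
  phi (emx a b) y' y2 * psi (emx y y3) x z.
Proof.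
have ue u w := uroe_emx mY uY u w.
have um := phi_uroe (uroe_emx mX uX a b).
have h1 := @mmul_emx_l R Y y y' (phi (emx a b)).
set m1 := (X in mmul_rel _ _ X) in h1.
have um1 : uroe dY m1 by apply: uroe_mul h1.
have h2 := @mmul_emx_r R Y y2 y3 m1.
set m2 := (X in mmul_rel _ _ X) in h2.
have m2E : m2 = mscale (phi (emx a b) y' y2) (emx y y3).
  apply/funext => u; apply/funext => w; rewrite /m2 /m1 /mscale /emx -mulnb
    natrM.
  by ring.
have um2 : uroe dY m2 by apply: uroe_mul h2.
have k1 := psi_mul (ue _ _) um um1 h1.
rewrite psiK in k1; last exact: uroe_emx.
have k1' := mmul_unique k1 (@mmul_emx_r R X a b (psi (emx y y'))).
have k2 := psi_mul um1 (ue _ _) um2 h2.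
rewrite k1' m2E psi_scale // in k2.
apply/esym; apply: (net_sum_unique (k2 x z)).
have -> : psi (emx y y') x a * psi (emx y2 y3) b z =
  psi (emx y y') x a * (b == b)%:R * psi (emx y2 y3) b z by rewrite eqxx mulr1.
apply: (net_sum_single (f := fun v => psi (emx y y') x a * (v == b)%:R *
  psi (emx y2 y3) v z)) => v vb.
by rewrite (negbTE vb) mulr0 mul0r.
Qed.

(** [star_iso] has no clause for the unit, but [psi 1] fixes [e_xx = psi (phi e_xx)] under left
    multiplication, which determines its column [x]. *)
Lemma psi_id : psi (chi predT) = chi predT.
Proof.
have u1 := uroe_chi mY uY predT.
apply/funext => u; apply/funext => x.
have um := phi_uroe (uroe_emx mX uX x x).
have h1 : mmul_rel (chi predT) (phi (emx x x)) (phi (emx x x)).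
  have := @mmul_chi_l R Y predT (phi (emx x x)).
  by congr mmul_rel; apply/funext => v; apply/funext => w; rewrite /= mul1r.
have k := psi_mul u1 um um h1.
rewrite psiK in k; last exact: uroe_emx.
have := mmul_unique k (@mmul_emx_r R X x x (psi (chi predT))).
move=> /(congr1 (fun m => m u x)); rewrite eqxx mulr1 => <-.
by rewrite /emx /chi eqxx !andbT.
Qed.

Lemma psi_emx_adj y y' a b : psi (emx y y') a b = cj (psi (emx y' y) b a).
Proof. by rewrite -(@madj_emx R Y y' y) psi_adj //; apply: uroe_emx. Qed.

Lemma psi_chi_adj S : madj (psi (chi S)) = psi (chi S).
Proof. by rewrite -psi_adj ?madj_chi //; apply: uroe_chi. Qed.

Lemma psi_chi_mul S S' : mmul_rel (psi (chi S)) (psi (chi S'))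
  (psi (chi (fun x => S x && S' x))).
Proof. by apply: psi_mul; try apply: uroe_chi => //; apply: mmul_chi. Qed.

Lemma psi_chi_proj S : mmul_rel (psi (chi S)) (psi (chi S)) (psi (chi S)).
Proof.
have := psi_chi_mul S S; congr mmul_rel; congr psi; congr chi.
by apply/funext => x; rewrite /= andbb.
Qed.

Lemma psi_chi_opb S : opb (psi (chi S)) 1.
Proof.
by apply: opb_contraction; [exact: psi_chi_adj | exact: psi_chi_proj].
Qed.

Lemma psi_chi_add S S' : (forall x, ~~ (S x && S' x)) ->
  psi (chi (fun x => S x || S' x)) = madd (psi (chi S)) (psi (chi S')).
Proof. by move=> SS; rewrite -chi_add // psi_add //; apply: uroe_chi. Qed.

(** The identity [p x x = |p e_x|^2] for a projection [p]; it controls columns by diagonal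
    entries. *)
Lemma psi_chi_diag S x :
  net_sum (fun z => (nn (psi (chi S) z x))%:C) (psi (chi S) x x).
Proof.
move=> e e0; have [F0 K] := psi_chi_proj S x x e0; exists F0 => F uF sF.
have := K F uF sF; congr (`|_ - _| <= _); apply: eq_bigr => z _.
by rewrite -{1}psi_chi_adj /madj mulrC nnE.
Qed.

Lemma psi_diag_ge0 S x : psi (chi S) x x = (complex.Re (psi (chi S) x x))%:C /\
  0 <= complex.Re (psi (chi S) x x).
Proof.
have [h1 h2 _] := net_sum_ge0 (fun z => nn_ge0 _) (psi_chi_diag S x).
by split => //; have := h2 [::] isT; rewrite big_nil.
Qed.

(** If the diagonal vanished, [sandwich] would give [|psi (emx y y) a b|^2 = 0] for all entries,
    against injectivity. *)
Lemma psi_emx_neq0 y : exists o, psi (emx y y) o o != 0.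
Proof.
apply/not_existsP => h.
have h0 o : psi (emx y y) o o = 0 by apply/eqP; apply/negPn; apply/negP/h.
have E0 : psi (emx y y) = psi (mscale 0 (emx y y)).
  rewrite psi_scale; last exact: uroe_emx.
  apply/funext => a; apply/funext => b; rewrite /mscale mul0r.
  have := sandwich y y y y a a b b.
  rewrite h0 mulr0 [psi _ b a]psi_emx_adj mulrC nnE => /complexI /eqP.
  by rewrite nn_eq0 => /eqP.
have := psi_inj (uroe_emx mY uY y y) (uroe_scale 0 (uroe_emx mY uY y y)) E0.
move/(congr1 (fun m => m y y)); rewrite /mscale mul0r /emx eqxx => /eqP.
by rewrite oner_eq0.
Qed.

Lemma psi_emx_vector y : exists v : X -> C,
  [/\ forall a b, psi (emx y y) a b = v a * cj (v b),
    forall F, uniq F -> ns F v <= 1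
    & forall e, 0 < e -> exists F0 : seq X, forall F, uniq F ->
        {subset F0 <= F} -> 1 - e <= ns F v].
Proof.
have [o o0] := psi_emx_neq0 y.
set E := psi (emx y y) in o0 *.
have Eo : phi (emx o o) y y = E o o.
  by have := sandwich y y y y o o o o; rewrite -/E => /(mulIf o0).
have [] := psi_diag_ge0 (pred1 y) o; rewrite -emx_chi -/E => EoR Eo0.
set r := complex.Re (E o o) in EoR Eo0.
have r0 : 0 < r.
  rewrite lt_neqAle Eo0 andbT; apply/eqP => r0.
  by rewrite EoR -r0 eqxx in o0.
set w := Num.sqrt r.
have w0 : 0 < w by rewrite sqrtr_gt0.
have w2 : w ^+ 2 = r by rewrite sqr_sqrtr.
(* If [E = v v^*], column [o] of [E] is [v] times the conjugate of [v o]; the phase is fixed by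
   [v o = w > 0]. *)
pose v a := (w^-1)%:C * E a o.
have Ev a b : E a b = v a * cj (v b).
  have := sandwich y y y y o o a b; rewrite -/E Eo EoR => h.
  rewrite /v conjcM conj_real_complex -(psi_emx_adj y y o b) -/E.
  have -> : (w^-1)%:C * E a o * ((w^-1)%:C * E o b) =
    (w^-1 * w^-1)%:C * (E a o * E o b) by rewrite real_complexM; ring.
  rewrite h mulrA -real_complexM -w2.
  have -> : w^-1 * w^-1 * w ^+ 2 = 1 by field; exact: lt0r_neq0.
  by rewrite mul1r.
have vo : nn (v o) = r.
  by apply: (@complexI R); rewrite -nnE -Ev EoR.
(* The squares [|E x o|^2 = r |v x|^2] sum over [x] to [E o o = r], so [v] has norm one. *)
have [_ h1 h2] := net_sum_ge0 (fun z => nn_ge0 _) (psi_chi_diag (pred1 y) o).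
rewrite -emx_chi -/E -/r in h1 h2.
have sE F : \sum_(x <- F) nn (E x o) = r * ns F v.
  rewrite /ns mulr_sumr; apply: eq_bigr => x _.
  by rewrite Ev nnM nn_conj vo mulrC.
exists v; split => // [F uF|e e0].
  by have := h1 F uF; rewrite sE -[X in _ <= X]mulr1 ler_pM2l.
have re : 0 < r * e by rewrite mulr_gt0.
have [F0 K] := h2 _ re; exists F0 => F uF sF; have := K F uF sF.
by rewrite sE => h; rewrite -(ler_pM2l r0) mulrBr mulr1.
Qed.

End Pair.

(** Cancel the entry of [psi] in the sandwich identity; if it is zero, the dual identity makes the
    square of the entry of [phi] zero as well. *)
Lemma psi_phi_diag (X Y : eqType) (dX : X -> X -> R) (dY : Y -> Y -> R)
    (phi : mat R X -> mat R Y) (psi : mat R Y -> mat R X) y a :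
  is_metric dX -> is_metric dY -> ulf dX -> ulf dY ->
  iso_pair dX dY phi psi -> psi (emx y y) a a = phi (emx a a) y y.
Proof.
move=> mX mY uX uY H.
have h1 := sandwich mX mY uX uY H y y y y a a a a.
have h2 := sandwich mY mX uY uX (iso_pair_sym H) a a a a y y y y.
have [e0|e0] := eqVneq (psi (emx y y) a a) 0; last by have := mulIf e0 h1.
by move: h2; rewrite e0 mul0r => /eqP; rewrite mulf_eq0 orbb => /eqP ->.
Qed.

End IsomorphismPairs.

(* Baire category for the Cantor space of subsets of [Y]: the sets [Q' n] cover
   it, and [Q n] contains the closure of [Q' n]. *)
Lemma subsets_baire (Y : eqType) (Q Q' : nat -> pred Y -> Prop) :
  (forall n S, ~ Q n S -> exists G : seq Y, forall S', {in G, S =1 S'} ->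
     ~ Q' n S') ->
  (forall S, exists n, Q' n S) ->
  exists n (G : seq Y) S0, forall S, {in G, S0 =1 S} -> Q n S.
Proof.
move=> Qopen Qcover; apply: contrapT => nQ.
have step (p : nat * (seq Y * pred Y)) : exists p' : seq Y * pred Y,
    [/\ {subset p.2.1 <= p'.1}, {in p.2.1, p.2.2 =1 p'.2}
      & forall S, {in p'.1, p'.2 =1 S} -> ~ Q' p.1 S].
  case: p => n [G S0] /=.
  have [S [SG nS]] : exists S, {in G, S0 =1 S} /\ ~ Q n S.
    apply: contrapT => h; apply: nQ; exists n, G, S0 => S SG.
    by apply: contrapT => nS; apply: h; exists S.
  have [G' HG'] := Qopen n S nS.
  exists (G ++ G', S); split => //= [y yG|S' h]; first by rewrite mem_cat yG.
  by apply: HG' => y yG; apply: h; rewrite mem_cat yG orbT.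
have [f Hf] := choice step.
pose fix it (n : nat) : seq Y * pred Y := if n is m.+1 then f (m, it m) else
  ([::], xpred0).
have mono n m : (n <= m)%N ->
    {subset (it n).1 <= (it m).1} /\ {in (it n).1, (it n).2 =1 (it m).2}.
  elim: m => [|m IH]; first by rewrite leqn0 => /eqP ->.
  rewrite leq_eqVlt => /orP[/eqP ->|]; first by split=> y.
  rewrite ltnS => /IH [h1 h2].
  have [k1 k2 _] := Hf (m, it m); split=> y yn; first exact/k1/h1.
  by rewrite h2 //; apply/k2/h1.
(* This set agrees with every stage on its finite window, and stage [n.+1] excludes [Q' n]. *)
pose Sinf : pred Y := fun y => `[< exists n, y \in (it n).1 /\ (it n).2 y >].
have agree n : {in (it n).1, (it n).2 =1 Sinf}.
  move=> y yn; apply/idP/asboolP => [Sy|[m [ym Sy]]]; first by exists n.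
  have [nm|/ltnW mn] := leqP n m.
    by rewrite (proj2 (mono _ _ nm)).
  by rewrite -(proj2 (mono _ _ mn)).
have [n Qn] := Qcover Sinf.
by have [_ _ /(_ Sinf (agree n.+1))] := Hf (n, it n).
Qed.

(** * Quasi-locality uniform over all subsets *)

Section Vectors.
Variable R : realType.
Local Notation C := R[i].
Local Notation cj := (@conjc R).
Variables (X Y : eqType) (dX : X -> X -> R) (dY : Y -> Y -> R).
Variables (phi : mat R X -> mat R Y) (psi : mat R Y -> mat R X).
Hypotheses (mX : is_metric dX) (mY : is_metric dY) (uX : ulf dX) (uY : ulf dY).
Hypothesis H : iso_pair dX dY phi psi.
Variable V : Y -> X -> C.
Hypothesis VE : forall y a b, psi (emx y y) a b = V y a * cj (V y b).
Hypothesis colV : forall x e, 0 < e -> exists G : seq Y, forall F, uniq F ->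
  {subset G <= F} -> 1 - e <= \sum_(y <- F) nn (V y x).
Implicit Types (S : pred Y) (s t F : seq X) (G : seq Y) (xi : X -> C).

Local Notation q S := (psi (chi S)).
Local Notation qD := (psi_chi_add mY uY H).

Lemma psi_chi0 a b : q pred0 a b = 0.
Proof.
have := qD (S := pred0) (S' := pred0) (fun=> isT).
move/(congr1 (fun m => m a b)); rewrite /madd.
have -> : (fun x => pred0 x || pred0 x) = pred0 :> pred Y by [].
by move=> h; apply: (addrI (q pred0 a b)); rewrite -h addr0.
Qed.

Lemma psi_chi_seq G a b : uniq G ->
  q (fun y => y \in G) a b = \sum_(y <- G) V y a * cj (V y b).
Proof.
elim: G => [_|y G IH /= /andP[yG uG]].
  by rewrite big_nil -(psi_chi0 a b).
rewrite big_cons -IH // -VE emx_chi -[RHS]/(madd _ _ a b) -qD.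
  by congr (psi (chi _) a b); apply/funext => z; rewrite /= inE.
by move=> z /=; apply/negP => /andP[/eqP -> h]; rewrite h in yG.
Qed.

Lemma psi_chi_split S S' : q S = madd (q (fun y => S y && S' y))
  (q (fun y => S y && ~~ S' y)).
Proof.
rewrite -qD; last by move=> y /=; case: (S y) (S' y) => [] [].
by congr (psi (chi _)); apply/funext => y /=; case: (S y) (S' y) => [] [].
Qed.

(** Diagonal entry at [x] of [1 = P_G + P_S + P_rest], the last term being nonnegative. *)
Lemma psi_chi_diag_le S G x : uniq G -> (forall y, y \in G -> ~~ S y) ->
  complex.Re (q S x x) <= 1 - \sum_(y <- G) nn (V y x).
Proof.
move=> uG SG.
have h1 := psi_chi_split predT (fun y => y \in G).
rewrite (psi_id mX mY uX uY H) in h1.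
have h2 := psi_chi_split (fun y => y \notin G) S.
have e3 : (fun y => (y \notin G) && S y) = S.
  apply/funext => y /=; case: (boolP (S y)) => Sy; rewrite ?andbF // andbT.
  by apply/negP => /SG; rewrite Sy.
rewrite /= h2 e3 in h1.
move/(congr1 (fun m => complex.Re (m x x))): h1.
rewrite /madd !ReD psi_chi_seq // /chi eqxx /= Re_sum.
have -> : \sum_(y <- G) complex.Re (V y x * cj (V y x)) = \sum_(y <- G) nn (V y
  x).
  by apply: eq_bigr => y _; rewrite nnE.
have [_] := psi_diag_ge0 mY uY H (fun y => (y \notin G) && ~~ S y) x.
lra.
Qed.

(** Strong continuity of [S -> psi (chi S)] at the empty set: if [S] misses a [G] carrying nearly
    all of [sum_y |V y x|^2], the diagonal entry at [x], hence column [x] of the projection, is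
    small. *)
Lemma psi_chi_tail t xi e : 0 < e -> exists G, forall S,
  (forall y, y \in G -> ~~ S y) -> forall F, uniq F ->
  ns F (app t (q S) xi) <= e.
Proof.
elim: t e => [|x t IH] e e0.
  exists [::] => S _ F _; rewrite /ns big1 ?ltW // => x _.
  by rewrite /app big_nil nn0.
have e4 : 0 < e / 4 by lra.
have [G2 HG2] := IH _ e4.
have [g g0 gx] := small_factor e4 (nn_ge0 (xi x)).
have [G1 HG1] := colV x g0.
exists (G1 ++ G2) => S SG F uF.
rewrite (eq_ns (g := fun z => q S z x * xi x + app t (q S) xi z)); last first.
  by move=> z _; rewrite /app big_cons.
apply: le_trans (nsD _ _ _) _.
have h2 : ns F (app t (q S) xi) <= e / 4.
  by apply: HG2 => // y yG; apply: SG; rewrite mem_cat yG orbT.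
suff h1 : ns F (fun z => q S z x * xi x) <= e / 4 by lra.
rewrite nsZ.
have [_ k _] := net_sum_ge0 (fun z => nn_ge0 _) (psi_chi_diag mY uY H S x).
have {k} := k F uF; rewrite -/(ns F (fun z => q S z x)) => k1.
have k2 : complex.Re (q S x x) <= 1 - \sum_(y <- undup G1) nn (V y x).
  apply: psi_chi_diag_le; first exact: undup_uniq.
  by move=> y; rewrite mem_undup => yG; apply: SG; rewrite mem_cat yG.
have k3 := HG1 (undup G1) (undup_uniq _) ltac:(by move=> y; rewrite mem_undup).
have n0 := nn_ge0 (xi x); have n1 := ns_ge0 F (fun z => q S z x).
nra.
Qed.

(** Subsets of [G] give finite sums of matrices [psi (emx y y)], each quasi-local on its own; [qlD]
    doubles constants, hence [K / 4]. *)
Lemma ql_finite G K : 0 < K -> exists r, forall S,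
  (forall y, S y -> y \in G) -> ql dX (q S) K r.
Proof.
elim: G K => [|y G IH] K K0.
  exists 0 => S SG s t xi us ut st.
  have -> : S = pred0 by apply/funext => y; apply/negP => /SG.
  rewrite (eq_ns (g := fun=> 0)); last first.
    by move=> x _; rewrite /app big1 // => z _; rewrite psi_chi0 mul0r.
  by rewrite /ns big1 ?mulr_ge0 ?ns_ge0 ?(ltW K0) // => x _; rewrite nn0.
have K4 : 0 < K / 4 by lra.
have [r1 h1] := IH _ K4.
have [r2 h2] := uroe_ql (psi_uroe H (uroe_emx mY uY y y)) K4.
exists (`|r1| + `|r2|) => S SG.
have l1 : r1 <= `|r1| + `|r2|.
  by have := ler_norm r1; have := normr_ge0 r2; lra.
have l2 : r2 <= `|r1| + `|r2|.
  by have := ler_norm r2; have := normr_ge0 r1; lra.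
have [Sy|Sy] := boolP (S y); last first.
  apply: ql_le l1 (h1 S _); first lra.
  move=> z Sz; have := SG z Sz; rewrite inE => /orP[/eqP zy|//].
  by rewrite -zy Sz in Sy.
rewrite (psi_chi_split S (pred1 y)).
have -> : (fun z => S z && pred1 y z) = pred1 y.
  by apply/funext => z /=; case: eqP => [->|_]; rewrite ?Sy ?andbF.
have k1 : ql dX (q (fun z => S z && ~~ pred1 y z)) (K / 4) (`|r1| + `|r2|).
  apply: ql_le l1 (h1 _ _) => // z /= /andP[/SG]; rewrite inE.
  by case: eqP.
have k2 : ql dX (q (pred1 y)) (K / 4) (`|r1| + `|r2|).
  by rewrite -emx_chi; apply: ql_le l2 h2.
by apply: ql_le (qlD k2 k1) => //; lra.
Qed.

(* Baire yields a bound uniform over the sets with a prescribed trace on a finite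
   [G]; an arbitrary [S] differs from such a set only by subsets of [G]. *)
Lemma uniform_ql K : 0 < K -> exists r, forall S, ql dX (q S) K r.
Proof.
(* The closing decomposition costs [2 (K/4) + 2 (2 a + 2 a) = K]. *)
move=> K0; pose a := K / 16; have a0 : 0 < a by rewrite /a; lra.
(* The gap between [a / 4] and [a] absorbs the passage from [S'] to [S], a factor 2 and two tails of
   relative size [a / 16] with weight 4: [2 (a/4) + 8 (a/16) = a]. *)
pose Q n S := ql dX (q S) a n%:R; pose Q' n S := ql dX (q S) (a / 4) n%:R.
have Qopen n S : ~ Q n S -> exists G : seq Y, forall S', {in G, S =1 S'} ->
     ~ Q' n S'.
  move=> nQ.
  have [s [t [xi [us ut st bad]]]] : exists s t xi, [/\ uniq s, uniq t,
      sep dX n%:R s t & a * ns t xi < ns s (app t (q S) xi)].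
    apply: contrapT => h; apply: nQ => s t xi us ut st.
    rewrite leNgt; apply/negP => bad; apply: h; by exists s, t, xi.
  have xi0 : 0 < ns t xi.
    rewrite lt_neqAle ns_ge0 andbT; apply/eqP => z.
    have := psi_chi_opb mY uY H S xi us ut.
    by rewrite -z mul1r leNgt (le_lt_trans _ bad) // -z mulr0.
  have e0 : 0 < a * ns t xi / 16 by have := mulr_gt0 a0 xi0; lra.
  have [G HG] := psi_chi_tail t xi e0.
  exists G => S' SS' Q'S; have k0 := Q'S s t xi us ut st.
  have i1 := psi_chi_split S S'; have i2 := psi_chi_split S' S.
  have b1 := HG (fun y => S y && ~~ S' y) ltac:(by move=> y /SS' /= ->;
    case: (S' y)) s us.
  have b2 := HG (fun y => S' y && ~~ S y) ltac:(by move=> y /SS' /= ->;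
    case: (S' y)) s us.
  have c : (fun y => S' y && S y) = (fun y => S y && S' y).
    by apply/funext => y /=; rewrite andbC.
  rewrite c in i2.
  set m1 := psi _ in b1 i1; set m2 := psi _ in b2 i2.
  have E x : app t (q S) xi x = app t (q S') xi x + (app t m1 xi x + - app t m2
    xi x).
    by rewrite i1 i2 !appD; ring.
  have k1 : ns s (app t (q S) xi) <= 2 * ns s (app t (q S') xi) +
      2 * (2 * ns s (app t m1 xi) + 2 * ns s (app t m2 xi)).
    rewrite (eq_ns (fun x _ => E x)); apply: le_trans (nsD _ _ _) _.
    rewrite lerD2l; apply: ler_wpM2l => //; apply: le_trans (nsD _ _ _) _.
    by rewrite nsN.
  move: (ns s _) (ns s _) (ns s _) (ns s _) bad b1 b2 k0 k1 => w1 w2 w3 w4.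
  lra.
have Qcover S : exists n, Q' n S.
  have a4 : 0 < a / 4 by lra.
  have [r hr] := uroe_ql (psi_uroe H (uroe_chi mY uY S)) a4.
  exists (Num.truncn (`|r|)).+1; apply: ql_le hr => //.
  apply: le_trans (ler_norm r) _; apply: ltW.
  by have /andP[] := truncn_itv (normr_ge0 r).
have [n [G [S0 HS0]]] := subsets_baire Qopen Qcover.
have K4 : 0 < K / 4 by lra.
have [r hr] := ql_finite G K4.
exists (n%:R + `|r|) => S.
have l1 : n%:R <= n%:R + `|r| by rewrite lerDl.
have l2 : r <= n%:R + `|r|.
  by apply: le_trans (ler_norm r) _; rewrite lerDr.
(* Both [S1] and [S2] agree with [S0] on [G], and [chi S] is [chi S1 - chi S2] plus the projection
   of the part of [S] inside [G]. *)
pose S1 : pred Y := fun y => if y \in G then S0 y else S y.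
pose S2 : pred Y := (fun y => (y \in G) && S0 y).
have h1 : ql dX (q S1) a (n%:R + `|r|).
  by apply: ql_le l1 (HS0 S1 _) => // y yG; rewrite /S1 yG.
have h2 : ql dX (q S2) a (n%:R + `|r|).
  by apply: ql_le l1 (HS0 S2 _) => // y yG; rewrite /S2 /= yG.
have h3 : ql dX (q (fun y => S y && (y \in G))) (K / 4) (n%:R + `|r|).
  by apply: ql_le l2 (hr _ _) => // y /= /andP[].
have i1 := psi_chi_split S (fun y => y \in G).
have i2 := psi_chi_split S1 (fun y => y \in G).
have c1 : (fun y => S1 y && (y \in G)) = S2.
  by apply/funext => y; rewrite /S1 /S2 /=; case: (y \in G);
    rewrite ?andbT ?andbF.
have c2 : (fun y => S1 y && (y \notin G)) =
    (fun y => S y && (y \notin G)).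
  by apply/funext => y; rewrite /S1 /=; case: (y \in G); rewrite ?andbT ?andbF.
rewrite c1 c2 in i2.
have -> : q S = madd (q (fun y => S y && (y \in G))) (madd (q S1) (mopp (q
  S2))).
  rewrite i1 i2; apply/funext => x; apply/funext => z.
  by rewrite /madd /mopp; ring.
apply: ql_le (qlD h3 (qlD h1 (qlN h2))) => //.
by rewrite /a; lra.
Qed.

Definition vdot y t xi : C := \sum_(x <- t) cj (V y x) * xi x.

Lemma app_psi_chi_seq G t xi x : uniq G ->
  app t (q (fun y => y \in G)) xi x = \sum_(y <- G) V y x * vdot y t xi.
Proof.
move=> uG; rewrite /app; under eq_bigr do rewrite psi_chi_seq // mulr_suml.
rewrite exchange_big /=; apply: eq_bigr => y _; rewrite /vdot mulr_sumr.
by apply: eq_bigr => z _; rewrite mulrA.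
Qed.

(** Splitting [G] by sign exhibits the sum as a difference of two vectors [psi (chi S) xi], so the
    radius is independent of [G], the signs and [xi]. *)
Lemma signed_ql K : 0 < K -> exists r, forall G (sg : pred Y) s t xi,
  uniq G -> uniq s -> uniq t -> sep dX r s t ->
  ns s (fun x => \sum_(y <- G) (-1) ^+ sg y * (V y x * vdot y t xi))
    <= K * ns t xi.
Proof.
move=> K0; have K4 : 0 < K / 4 by lra.
have [r hr] := uniform_ql K4; exists r => G sg s t xi uG us ut st.
pose G1 := [seq y <- G | ~~ sg y]; pose G2 := [seq y <- G | sg y].
have h := qlD (hr (fun y => y \in G1)) (qlN (hr (fun y => y \in G2))).
have := h s t xi us ut st.
have -> : 2 * (K / 4) + 2 * (K / 4) = K by lra.
apply: le_trans; rewrite le_eqVlt; apply/orP; left; apply/eqP; apply: eq_ns.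
move=> x _; rewrite appD appN !app_psi_chi_seq ?filter_uniq //.
rewrite /G1 /G2 !big_filter -sumrN.
elim: (G) => [|y G' IH]; first by rewrite !big_nil addr0.
rewrite !big_cons IH; case: (sg y) => /=.
  by rewrite expr1; ring.
by rewrite expr0; ring.
Qed.

(** Parseval weakened by a factor 2, so that a finite [G] suffices. *)
Lemma vdot_complete t xi : uniq t -> exists2 G, uniq G &
  ns t xi / 2 <= \sum_(y <- G) nn (vdot y t xi).
Proof.
move=> ut; have := ns_ge0 t xi; rewrite le_eqVlt => /orP[/eqP z|p].
  by exists [::] => //; rewrite big_nil -z mul0r.
have e0 : 0 < ns t xi / 8 by lra.
have [G' HG] := psi_chi_tail t xi e0.
pose G := undup G'; have uG : uniq G by apply: undup_uniq.
exists G => //.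
have b := HG (fun y => y \notin G)
  ltac:(by move=> y /=; rewrite mem_undup => ->) t ut.
have h1 := psi_chi_split predT (fun y => y \in G).
rewrite (psi_id mX mY uX uY H) in h1.
set m := psi (chi (fun y => y \notin G)) in b.
rewrite /= -/m in h1.
have E x : x \in t -> xi x = \sum_(y <- G) V y x * vdot y t xi + app t m xi x.
  move=> xt; rewrite -app_psi_chi_seq // -appD -h1 /app.
  rewrite (bigD1_seq x) //= big1 ?addr0; last first.
    by move=> z zx; rewrite /chi eq_sym (negbTE zx) mul0r.
  by rewrite /chi eqxx mul1r.
have S1 : (ns t xi)%:C = (\sum_(y <- G) nn (vdot y t xi))%:C +
    \sum_(x <- t) cj (xi x) * app t m xi x.
  rewrite -ip_self.
  transitivity (\sum_(x <- t) (cj (xi x) * (\sum_(y <- G) V y x * vdot y t xi) +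
     cj (xi x) * app t m xi x)).
    by apply: eq_big_seq => x xt; rewrite -mulrDr -E.
  rewrite big_split /=; congr (_ + _).
  under eq_bigr do rewrite mulr_sumr.
  rewrite exchange_big /= rmorph_sum; apply: eq_bigr => y _.
  rewrite -[RHS]nnE -[RHS]mulrC /vdot conjc_sum mulr_suml.
  by apply: eq_bigr => x _; rewrite conjcM conjcK; ring.
have S2 := congr1 (@complex.Re R) S1; rewrite ReD /= in S2.
(* With weights 1/2 and 2 the cross term is at most [(1/4 + 4/8) / 2 = 3/8] of [ns t xi]. *)
have := ip_le t (fun x => (2^-1)%:C * xi x) (fun x => 2%:C * app t m xi x).
have -> : \sum_(x <- t) cj ((2^-1)%:C * xi x) * (2%:C * app t m xi x) =
    \sum_(x <- t) cj (xi x) * app t m xi x.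
  apply: eq_bigr => x _; rewrite conjcM conj_real_complex.
  have e : (2^-1)%:C * 2%:C = 1 :> C.
    by rewrite -real_complexM mulVf // pnatr_eq0.
  by rewrite mulrACA e mul1r.
have nsc (D : R) f : ns t (fun x => D%:C * f x) = D ^+ 2 * ns t f.
  by rewrite /ns mulr_sumr; apply: eq_bigr => x _; rewrite nnM nn_real.
rewrite !nsc.
have -> : (2^-1 : R) ^+ 2 = 1 / 4 by field.
lra.
Qed.

(* [e_{y y'} = e_{y y} w e_{y' y'}] for the single finite propagation matrix
   [w = nbr r], so its image is quasi-local uniformly in [d y y' <= r]. *)
Lemma vectors_coarse (r c : R) : 0 < c -> exists s : R, forall y y' a b,
  dY y y' <= r -> c <= nn (V y a) -> c <= nn (V y' b) -> dX a b <= s.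
Proof.
move=> c0.
have uW := psi_uroe H (uroe_nbr mY uY r); set W := psi _ in uW.
have [M M0 WM] := uroe_opb uW.
(* Two uses of [ql_mul] turn [K] into [K * (6 M + 4) = c^2 / 2], too small for
   [|psi (emx y y') a b|^2 >= c^2]. *)
pose K := c ^+ 2 / (2 * (6 * M + 4)).
have K0 : 0 < K by rewrite divr_gt0 ?exprn_gt0 //; lra.
have KE : K * (6 * M + 4) = c ^+ 2 / 2 by rewrite /K; field; lra.
have [r0 h0] := uniform_ql K0; have [r1 h1] := uroe_ql uW K0.
exists (r0 + r1 + r0) => y y' a b dyy ya yb.
rewrite leNgt; apply/negP => dab.
have ue u w := uroe_emx mY uY u w.
have m1 := @mmul_emx_l R Y y y (nbr dY r).
set e1 := (X in mmul_rel _ _ X) in m1.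
have ue1 : uroe dY e1 by apply: uroe_mul m1 => //; apply: uroe_nbr.
have m2 := @mmul_emx_r R Y y' y' e1.
set e2 := (X in mmul_rel _ _ X) in m2.
have e2E : e2 = emx y y'.
  apply/funext => u; apply/funext => w; rewrite /e2 /e1 /nbr dyy mulr1 /emx.
  by rewrite -mulnb natrM.
rewrite e2E in m2.
have k1 := psi_mul H (ue _ _) (uroe_nbr mY uY r) ue1 m1.
have k2 := psi_mul H ue1 (ue _ _) (ue _ _) m2.
rewrite -/W !emx_chi in k1 k2.
have o1 := opb_mul ler01 (psi_chi_opb mY uY H _) WM k1.
have l1 := ql_mul mX ler01 (ltW K0) (psi_chi_opb mY uY H _) WM (h0 _) h1 k1.
rewrite mul1r in o1.
have K1 : 0 <= 2 * (K * M) + 2 * (1 * K) by nra.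
have l2 := ql_mul mX M0 K1 o1 (psi_chi_opb mY uY H _) l1 (h0 _) k2.
have := ql_entry l2 dab.
have P : nn (psi (emx y y') a b) = nn (V y' b) * nn (V y a).
  have := sandwich mX mY uX uY H y y' y' y b b a a.
  rewrite (psi_emx_adj mY uY H y' y b a) nnE.
  rewrite -(psi_phi_diag _ _ mX mY uX uY H) !VE !nnE -real_complexM.
  by move/complexI.
rewrite P; have n1 := nn_ge0 (V y' b); have n2 := nn_ge0 (V y a).
have : c ^+ 2 <= nn (V y' b) * nn (V y a) by rewrite expr2;
  apply: ler_pM => //; exact: ltW.
have c2 : 0 < c ^+ 2 by rewrite exprn_gt0.
move: (nn _ * nn _) => w; lra.
Qed.

End Vectors.

(** * Concentration of the vectors and Hall's condition *)

Section Concentration.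
Variable R : realType.
Local Notation C := R[i].
Local Notation cj := (@conjc R).

Lemma ns_parallelogram (T : eqType) (Z : seq T) (f g : T -> C) :
  ns Z (fun x => f x + g x) + ns Z (fun x => - f x + g x) =
  2 * ns Z f + 2 * ns Z g.
Proof.
rewrite /ns !mulr_sumr -!big_split /=; apply: eq_bigr => x _.
by case: (f x) (g x) => a b [c d]; rewrite /nn /=; ring.
Qed.

(** By the parallelogram identity the squared norms of [f + w] and [f - w] average to the sum of
    those of [f] and [w], so signs can be chosen greedily without loss: a deterministic form of
    averaging over random signs. *)
Lemma large_signed_sum (T Y : eqType) (Z : seq T) (w : Y -> T -> C) (G : seq Y)
  :
  uniq G -> exists sg : pred Y, \sum_(y <- G) ns Z (w y) <=
    ns Z (fun x => \sum_(y <- G) (-1) ^+ sg y * w y x).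
Proof.
elim: G => [_|y G IH /= /andP[yG uG]].
  by exists pred0; rewrite big_nil; apply: ns_ge0.
have [sg Hsg] := IH uG.
pose f x := \sum_(y <- G) (-1) ^+ sg y * w y x.
have ext (b : bool) x : \sum_(z <- y :: G)
    (-1) ^+ (if z == y then b else sg z) * w z x = (-1) ^+ b * w y x + f x.
  rewrite big_cons eqxx; congr (_ + _); apply: eq_big_seq => z zG.
  by case: eqP => // zy; rewrite -zy zG in yG.
have := ns_parallelogram Z (w y) f; rewrite big_cons => par.
have [h|h] := leP (ns Z (w y) + ns Z f) (ns Z (fun x => w y x + f x)).
  exists (fun z => if z == y then false else sg z).
  apply: le_trans (_ : ns Z (fun x => w y x + f x) <= _).
    by apply: le_trans h; rewrite lerD2l.
  rewrite le_eqVlt; apply/orP; left; apply/eqP; apply: eq_ns => x _.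
  by rewrite ext expr0 mul1r.
exists (fun z => if z == y then true else sg z).
apply: le_trans (_ : ns Z (fun x => - w y x + f x) <= _).
  rewrite -/(ns Z f) in Hsg *; lra.
rewrite le_eqVlt; apply/orP; left; apply/eqP; apply: eq_ns => x _.
by rewrite ext expr1 mulN1r.
Qed.

(** A duplicate-free list of maximal length inside the ball exhausts it. *)
Lemma ball_seq (X : eqType) (d : X -> X -> R) (r : R) : ulf d -> 0 < r ->
  exists N : nat, forall x, exists s : seq X,
    [/\ uniq s, (size s <= N)%N & forall y, (y \in s) = (d x y <= r)].
Proof.
move=> ud r0; have [N HN] := ud r r0; exists N => x.
pose P n := `[< exists s : seq X, [/\ uniq s, forall y, y \in s -> d x y <= r &
  size s = n] >].
have P0 : exists n, P n by exists 0%N; apply/asboolP; exists [::].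
have PN n : P n -> (n <= N)%N by move=> /asboolP[s [us sr <-]]; apply: HN sr.
case: (ex_maxnP P0 PN) => n /asboolP[s [us sr sn]] nmax.
exists s; split => //; first exact: HN sr.
move=> y; apply/idP/idP; first exact: sr.
move=> dy; apply: contraT => ys.
have : P n.+1.
  apply/asboolP; exists (y :: s); rewrite /= ys us sn; split => // z.
  by rewrite inE => /orP[/eqP ->//|/sr].
by move/nmax; rewrite ltnn.
Qed.

(** Fewer equations than unknowns: the coefficient matrix has a nonzero left kernel. *)
Lemma nontrivial_solution (X Y : eqType) (A : seq X) (G : seq Y) (f : Y -> X ->
  C) :
  uniq A -> (size G < size A)%N -> exists2 xi : X -> C,
    exists2 x, x \in A & xi x != 0
    & forall y, y \in G -> \sum_(x <- A) f y x * xi x = 0.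
Proof.
move=> uA sGA.
pose M := \matrix_(i < size A, j < size G)
  f (tnth (in_tuple G) j) (tnth (in_tuple A) i).
have : kermx M != 0.
  rewrite -mxrank_eq0 mxrank_ker -lt0n subn_gt0.
  exact: leq_ltn_trans (rank_leq_col M) sGA.
case/rowV0Pn => v /sub_kermxP vM v0.
pose xi x : C := if insub (index x A) is Some i then v 0 i else 0.
have xiE (i : 'I_(size A)) : xi (tnth (in_tuple A) i) = v 0 i.
  rewrite /xi (tnth_nth (tnth (in_tuple A) i)) /= index_uniq //.
  by rewrite valK.
exists xi.
  have [i vi] : exists i, v 0 i != 0.
    apply/existsP; apply: contraNT v0 => /existsPn h.
    by apply/eqP/rowP => i; rewrite mxE; apply/eqP; have := h i; rewrite negbK.
  by exists (tnth (in_tuple A) i); [exact: mem_tnth | rewrite xiE].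
move=> y yG.
have [j yj] : exists j, y = tnth (in_tuple G) j by apply/tnthP.
have := congr1 (fun m : 'rV__ => m 0 j) vM; rewrite !mxE => vM0.
rewrite -[RHS]vM0 big_tnth; apply: eq_bigr => i _.
by rewrite xiE mxE -yj mulrC.
Qed.

Section Core.
Variables (X Y : eqType) (dX : X -> X -> R).
Hypotheses (mX : is_metric dX) (uX : ulf dX).
Variable V : Y -> X -> C.
Local Notation vdotV := (vdot V).
Hypothesis signedV : forall K, 0 < K -> exists r,
  forall (G : seq Y) (sg : pred Y) (s t : seq X) xi,
  uniq G -> uniq s -> uniq t -> sep dX r s t ->
  ns s (fun x => \sum_(y <- G) (-1) ^+ sg y * (V y x * vdotV y t xi))
    <= K * ns t xi.
Hypothesis rowV : forall y e, 0 < e -> exists F0 : seq X, forall F, uniq F ->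
  {subset F0 <= F} -> 1 - e <= ns F (V y).
Hypothesis colV : forall x e, 0 < e -> exists G : seq Y, forall F, uniq F ->
  {subset G <= F} -> 1 - e <= \sum_(y <- F) nn (V y x).
Hypothesis colV1 : forall x G, uniq G -> \sum_(y <- G) nn (V y x) <= 1.
Hypothesis completeV : forall (t : seq X) xi, uniq t -> exists2 G, uniq G &
  ns t xi / 2 <= \sum_(y <- G) nn (vdotV y t xi).

Lemma rows_finite (G : seq Y) e : 0 < e -> exists F0 : seq X, forall F, uniq F
  ->
  {subset F0 <= F} -> forall y, y \in G -> 1 - e <= ns F (V y).
Proof.
move=> e0.
by apply: (finite_eventually (P := fun y F => 1 - e <= ns F (V y))) => y _;
  apply: rowV.
Qed.

(** The signs from [large_signed_sum] depend on [s] and [xi], so [r] must be fixed before them, as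
    [signedV] permits. *)
Lemma signed_bound K : 0 < K -> exists r, forall (G : seq Y) (s t : seq X) xi,
  uniq G -> uniq s -> uniq t -> sep dX r s t ->
  \sum_(y <- G) nn (vdotV y t xi) * ns s (V y) <= K * ns t xi.
Proof.
move=> K0; have [r hr] := signedV K0; exists r => G s t xi uG us ut st.
have [sg hsg] := large_signed_sum s (fun y x => V y x * vdotV y t xi) uG.
apply: le_trans (hr G sg s t xi uG us ut st); apply: le_trans hsg.
by apply: ler_sum => y _; rewrite nsZ mulrC.
Qed.

Lemma vdot1 y x : vdotV y [:: x] (fun=> 1) = cj (V y x).
Proof. by rewrite /vdot big_seq1 mulr1. Qed.

(** Suppose all [|V y x|^2] are at most [c], and weight the mass of each [V y] by [|V y x|^2].
    Outside a ball about [x] the weighted mass is at most 1/4 by [signed_bound]; inside it is at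
    most [c * N <= 1/4], as columns have norm at most one. But the total is at least
    [(3/4)^2 > 1/2]. *)
Lemma entry_lower_bound : exists2 c, 0 < c & forall x, exists y, c <= nn (V y
  x).
Proof.
have q4 : 0 < 1 / 4 :> R by lra.
have [r0 hr0] := signed_bound q4.
have rp : 0 < `|r0| + 1 by have := normr_ge0 r0; lra.
have [N HN] := ball_seq uX rp.
have N0 : 0 <= N%:R :> R by [].
pose c : R := 1 / (4 * (N%:R + 1)).
have c0 : 0 < c by rewrite divr_gt0 //; lra.
have cN : c * (N%:R + 1) = 1 / 4 by rewrite /c; field; lra.
exists c => // x; apply: contrapT => nx.
have small y : nn (V y x) <= c.
  by rewrite leNgt; apply/negP => h; apply: nx; exists y; apply: ltW.
have [B [uB sB inB]] := HN x.
have [G0 HG0] := colV x q4; pose G := undup G0.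
have uG : uniq G by apply: undup_uniq.
have {HG0} hG := HG0 G uG ltac:(by move=> y; rewrite mem_undup).
have [F0 HF0] := rows_finite G q4.
pose F := undup F0; have uF : uniq F by apply: undup_uniq.
have {HF0} hF := HF0 F uF ltac:(by move=> y; rewrite mem_undup).
pose Z := [seq a <- F | a \notin B]; have uZ : uniq Z by apply: filter_uniq.
have sepZ : sep dX r0 Z [:: x].
  move=> a b; rewrite mem_filter inB -ltNge => /andP[h _];
    rewrite inE => /eqP ->.
  case: mX => _ [_ [dC _]]; rewrite dC; have := ler_norm r0; lra.
have := hr0 G Z [:: x] (fun=> 1) uG uZ isT sepZ.
rewrite ns1 nn1 mulr1 => h1.
have h2 : \sum_(y <- G) nn (V y x) * (3 / 4) <= \sum_(y <- G) nn (V y x) * ns Z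
  (V y)
    + \sum_(y <- G) c * ns B (V y).
  rewrite -big_split /= big_seq [X in _ <= X]big_seq; apply: ler_sum => y yG.
  have := hF y yG; rewrite (ns_filter (fun a => a \in B) F (V y)).
  have : ns [seq a <- F | a \in B] (V y) <= ns B (V y).
    by apply: ns_subset; [exact: filter_uniq | move=> a;
      rewrite mem_filter => /andP[]].
  rewrite -/Z.
  have := small y; have := nn_ge0 (V y x); have := ns_ge0 B (V y).
  have := ns_ge0 Z (V y); nra.
have h3 : \sum_(y <- G) c * ns B (V y) <= c * N%:R.
  rewrite -mulr_sumr; apply: ler_wpM2l; first exact: ltW.
  rewrite /ns exchange_big /=.
  apply: (@le_trans _ _ (\sum_(a <- B) 1)).
    by apply: ler_sum => a _; apply: colV1.
  by rewrite big_const_seq count_predT iter_addr_0 ler_nat.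
have h4 : \sum_(y <- G) nn (vdotV y [:: x] (fun=> 1)) * ns Z (V y) =
    \sum_(y <- G) nn (V y x) * ns Z (V y).
  by apply: eq_bigr => y _; rewrite vdot1 nn_conj.
rewrite h4 in h1; rewrite -mulr_suml in h2.
move: (\sum_(y <- G) nn (V y x) * ns Z (V y)) h1 h2 => w h1 h2.
lra.
Qed.

(** [signed_bound] for a single [y] and the unit vector at [x]: the weight [|V y x|^2 >= c] is
    divided out. *)
Lemma concentration c e : 0 < c -> 0 < e -> exists s, forall y x Z,
  c <= nn (V y x) -> uniq Z -> (forall a, a \in Z -> s < dX a x) ->
  ns Z (V y) <= e.
Proof.
move=> c0 e0; have ce : 0 < c * e by rewrite mulr_gt0.
have [r hr] := signed_bound ce; exists r => y x Z cy uZ hZ.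
have := hr [:: y] Z [:: x] (fun=> 1) isT uZ isT.
rewrite big_seq1 vdot1 nn_conj ns1 nn1 mulr1 => h.
have {h} h := h ltac:(by move=> a b aZ; rewrite inE => /eqP ->; apply: hZ).
rewrite -(ler_pM2l c0); apply: le_trans h.
by apply: ler_wpM2r => //; apply: ns_ge0.
Qed.

Lemma hall_condition (g : Y -> X) c : 0 < c -> (forall y, c <= nn (V y (g y)))
  ->
  exists M, forall (A : seq X) (G : seq Y), uniq A ->
    (forall y x, x \in A -> dX x (g y) <= M -> y \in G) -> (size A <= size G)%N.
Proof.
move=> c0 hg.
have e1 : 0 < 1 / 32 :> R by lra.
have e2 : 0 < 1 / 4 :> R by lra.
have [r hr] := signed_bound e1; have [s hs] := concentration c0 e2.
(* If [g y] is farther than this from [A], every point within [r] of [A] is farther than [s] from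
   [g y], so [V y] has mass at most 1/4 on such points. *)
exists (`|r| + `|s|) => A H uA AH; rewrite leqNgt; apply/negP => HA.
have [xi [x0 x0A x00] xiH] := nontrivial_solution (fun y x => cj (V y x)) uA HA.
have xi0 : 0 < ns A xi.
  rewrite lt_neqAle ns_ge0 andbT; apply/eqP => z.
  have /ns_eq0 h : ns A xi <= 0 by rewrite -z.
  by rewrite h // eqxx in x00.
have [G0 uG0 hG0] := completeV xi uA.
pose G := [seq y <- G0 | y \notin H]; have uG : uniq G by apply: filter_uniq.
have sumG : \sum_(y <- G) nn (vdotV y A xi) = \sum_(y <- G0) nn (vdotV y A xi).
  rewrite big_filter big_mkcond /=; apply: eq_bigr => y _.
  by case: ifPn => //; rewrite negbK => yH; rewrite /vdot xiH // nn0.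
have [F0 HF0] := rows_finite G e2.
pose F := undup F0; have uF : uniq F by apply: undup_uniq.
have {HF0} hF := HF0 F uF ltac:(by move=> y; rewrite mem_undup).
pose far a := all (fun x => r < dX a x) A.
pose Z := filter far F; have uZ : uniq Z by apply: filter_uniq.
have sepZ : sep dX r Z A.
  by move=> a x; rewrite mem_filter => /andP[/allP h _]; apply: h.
have := hr G Z A xi uG uZ uA sepZ.
case: (mX) => _ [_ [dC tri]].
have hZ y : y \in G -> 1 / 2 <= ns Z (V y).
  move=> yG; have := hF y yG; rewrite (ns_filter far F (V y)) -/Z.
  suff: ns (filter (predC far) F) (V y) <= 1 / 4 by lra.
  apply: hs (hg y) _ _; first exact: filter_uniq.
  move=> a; rewrite mem_filter => /andP[/allPn[x xA] + _].
  rewrite -leNgt => dax; rewrite ltNge; apply/negP => dag.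
  move: yG; rewrite mem_filter => /andP[/negP yH _]; apply: yH.
  apply: (AH y x xA); have := tri x a (g y); rewrite (dC x a).
  have := ler_norm r; have := ler_norm s; lra.
(* The indices in [G] keep half of [ns A xi] by [completeV], and [Z] carries mass at least 1/2 of
   each [V y]; a quarter would thus be at most 1/32. *)
have : \sum_(y <- G) nn (vdotV y A xi) * (1 / 2) <=
    \sum_(y <- G) nn (vdotV y A xi) * ns Z (V y).
  rewrite big_seq [X in _ <= X]big_seq; apply: ler_sum => y yG.
  by apply: ler_wpM2l; [exact: nn_ge0 | exact: hZ].
rewrite -mulr_suml sumG.
move: (\sum_(y <- G) _) (\sum_(y <- G0) _) hG0 => w w' hG0; lra.
Qed.

End Core.
End Concentration.

(** * Hall's theorem for infinite families of finite sets *)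

Section Hall.
Variables X Y : choiceType.
Local Open Scope nat_scope.
Local Open Scope fset_scope.
Implicit Types (N : X -> {fset Y}) (A : {fset X}).

Definition image_fset N A : {fset Y} := \bigcup_(x <- A) N x.

Definition hall N := forall A, #|` A| <= #|` image_fset N A|.

Lemma mem_image_fset N A y :
  reflect (exists2 x, x \in A & y \in N x) (y \in image_fset N A).
Proof.
by apply: (iffP (bigfcupP _ _ _ _)) => -[x xA yN]; exists x;
  rewrite ?andbT in xA *.
Qed.

Lemma eq_image_fset N N' A : {in A, N =1 N'} -> image_fset N A = image_fset N'
  A.
Proof.
by move=> h; apply/fsetP => y; apply/mem_image_fset/mem_image_fset => -[x xA
  yx];
  exists x => //; rewrite ?h // -?h.
Qed.

(** The infimum of the chain takes at each [x] a set of least cardinality. On a finite [A] a single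
    member of the chain attains all these minima, and Hall's condition concerns only finite [A]. *)
Lemma hall_chain (T : Type) (F : T -> X -> {fset Y}) (ch : T -> Prop) t0 : ch
  t0 ->
  (forall t, hall (F t)) ->
  (forall s t, ch s -> ch t -> (forall x, F s x `<=` F t x) \/
     (forall x, F t x `<=` F s x)) ->
  exists2 N, hall N & forall t, ch t -> forall x, N x `<=` F t x.
Proof.
move=> ch0 hF tot.
have mn x : exists t, ch t /\ forall s, ch s -> #|` F t x| <= #|` F s x|.
  pose P n := `[< exists2 t, ch t & #|` F t x| = n >].
  have exP : exists n, P n by exists #|` F t0 x|; apply/asboolP; exists t0.
  case: (ex_minnP exP) => n /asboolP[t ct tn] nmin.
  by exists t; split => // s cs; rewrite tn; apply: nmin; apply/asboolP;
    exists s.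
have [m Hm] := choice mn.
pose N x := F (m x) x.
have Nle t : ch t -> forall x, N x `<=` F t x.
  move=> ct x; have [cm mm] := Hm x.
  have [h|h] := tot _ _ cm ct; first exact: h.
  have := eqEfcard (F t x) (F (m x) x); rewrite h mm // => /eqP.
  by rewrite /N => ->.
exists N => // A.
suff [t ct tA] : exists2 t, ch t & {in A, F t =1 N}.
  by rewrite -(eq_image_fset tA); apply: hF.
have: exists2 t, ch t & forall x, x \in (A : seq X) -> F t x = N x.
  elim: (A : seq X) => [|x s [t ct IH]]; first by exists t0.
  have [cm _] := Hm x.
  have [h|h] := tot _ _ cm ct.
    exists (m x) => // z; rewrite inE => /orP[/eqP -> //|zs].
    by apply/eqP; rewrite eqEfsubset Nle // andbT -(IH z zs).
  exists t => // z; rewrite inE => /orP[/eqP ->|/IH //].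
  by apply/eqP; rewrite eqEfsubset Nle // andbT.
by case=> t ct tA; exists t.
Qed.

Lemma hall_minimal N : hall N -> exists N', [/\ hall N',
  forall x, N' x `<=` N x & forall N'', hall N'' ->
    (forall x, N'' x `<=` N' x) -> N'' = N'].
Proof.
move=> hN.
pose T := {N' : X -> {fset Y} | hall N' /\ forall x, N' x `<=` N x}.
pose r (s t : T) := `[< forall x, sval t x `<=` sval s x >].
have t0 : T by exists N; split => // x; apply: fsubset_refl.
have [||B tot|t tmax] := @ZL_preorder T t0 r.
- by move=> t; apply/asboolP => x; apply: fsubset_refl.
- move=> s t u /asboolP st /asboolP tu; apply/asboolP => x.
  exact: fsubset_trans (tu x) (st x).
- have [[b Bb]|nB] := pselect (exists b, B b); last first.
    by exists t0 => s Bs; case: nB; exists s.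
  have [|s u Bs Bu|M hM Mle] := @hall_chain T (fun t => sval t) B b Bb.
  + by move=> s; case: (svalP s).
  + by have [/asboolP|/asboolP] := tot s u Bs Bu; [right | left].
  have hMN : hall M /\ forall x, M x `<=` N x.
    split=> // x; apply: fsubset_trans (Mle b Bb x) _.
    by case: (svalP b) => _; apply.
  by exists (exist _ M hMN) => s Bs; apply/asboolP => x; apply: Mle.
case: (svalP t) => ht tN.
exists (sval t); split => // N'' hN'' le.
have hMN : hall N'' /\ forall x, N'' x `<=` N x.
  by split=> // x; apply: fsubset_trans (le x) (tN x).
have /asboolP ge := tmax (exist _ N'' hMN) (introT (asboolP _) le).
by apply/funext => x; apply/eqP; rewrite eqEfsubset le ge.
Qed.

Definition hall_remove N x0 y0 : X -> {fset Y} :=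
  fun x => if x == x0 then N x `\ y0 else N x.

(** A set violating the condition after the removal must contain [x0]; taking [x0] out of it lowers
    the strict inequality to a weak one. *)
Lemma hall_remove_fail N x0 y0 : hall N -> ~ hall (hall_remove N x0 y0) ->
  exists2 A, x0 \notin A & #|` image_fset N A `|` (N x0 `\ y0)| <= #|` A|.
Proof.
move=> hN nh.
have [A hA] : exists A, #|` image_fset (hall_remove N x0 y0) A| < #|` A|.
  apply: contrapT => h; apply: nh => A; rewrite leqNgt; apply/negP => hA.
  by apply: h; exists A.
have x0A : x0 \in A.
  apply: contraT => x0A; have := hN A; rewrite leqNgt => /negP; case.
  rewrite -(@eq_image_fset (hall_remove N x0 y0)) // => x xA.
  rewrite /hall_remove; case: eqP => // xx; by rewrite -xx xA in x0A.
exists (A `\ x0); first by rewrite !inE eqxx.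
have cA := cardfsD1 x0 A; rewrite x0A in cA.
suff: #|` image_fset N (A `\ x0) `|` (N x0 `\ y0)| <=
    #|` image_fset (hall_remove N x0 y0) A| by lia.
apply: fsubset_leq_card; apply/fsubsetP => y; rewrite in_fsetU => /orP[].
  case/mem_image_fset => x; rewrite in_fsetD1 => /andP[xx xA] yx.
  by apply/mem_image_fset; exists x => //; rewrite /hall_remove (negbTE xx).
move=> yx; apply/mem_image_fset; exists x0 => //.
by rewrite /hall_remove eqxx.
Qed.

(* Rado: in a minimal family satisfying Hall's condition every set is a
   singleton, since two removable points contradict submodularity. *)
Lemma hall_matching N : hall N -> exists h : X -> Y,
  injective h /\ forall x, h x \in N x.
Proof.
move=> /hall_minimal[M [hM MN Mmin]].
have uniqM x y1 y2 : y1 \in M x -> y2 \in M x -> y1 = y2.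
  move=> h1 h2; apply/eqP; apply: contraT => y12.
  have nh y : y \in M x -> ~ hall (hall_remove M x y).
    move=> yM hy; have E := Mmin _ hy.
    have /(congr1 (fun f => f x)) : hall_remove M x y = M.
      apply: E => z; rewrite /hall_remove; case: eqP => // _.
      by apply/fsubsetP => u; rewrite in_fsetD1 => /andP[].
    by rewrite /hall_remove eqxx => /fsetP/(_ y); rewrite !inE eqxx yM.
  have [A1 xA1 c1] := hall_remove_fail hM (nh _ h1).
  have [A2 xA2 c2] := hall_remove_fail hM (nh _ h2).
  set B1 := _ `|` _ in c1; set B2 := _ `|` _ in c2.
  (* Since [y1] and [y2] differ, the two reduced copies of [M x] together cover [M x]. *)
  have hU : #|` x |` (A1 `|` A2)| <= #|` B1 `|` B2|.
    apply: leq_trans (hM _) _; apply: fsubset_leq_card; apply/fsubsetP => y.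
    case/mem_image_fset => z; rewrite in_fset1U in_fsetU => zA yz.
    rewrite in_fsetU /B1 /B2 !in_fsetU !in_fsetD1.
    case/orP: zA => [/eqP zx|/orP[zA|zA]].
    - rewrite -zx yz !andbT; have [yy|] := eqVneq y y1; last by rewrite orbT.
      by rewrite yy y12 !orbT.
    - have -> : y \in image_fset M A1 by apply/mem_image_fset; exists z.
      by [].
    have -> : y \in image_fset M A2 by apply/mem_image_fset; exists z.
    by rewrite !orbT.
  have hI : #|` A1 `&` A2| <= #|` B1 `&` B2|.
    apply: leq_trans (hM _) _; apply: fsubset_leq_card; apply/fsubsetP => y.
    case/mem_image_fset => z; rewrite in_fsetI => /andP[z1 z2] yz.
    rewrite in_fsetI /B1 /B2 !in_fsetU; apply/andP; split; apply/orP; left;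
      by apply/mem_image_fset; exists z.
  (* Adding up unions and intersections: [|A1| + |A2| + 1 <= |B1| + |B2| <= |A1| + |A2|]. *)
  have e1 := cardfsUI A1 A2; have e2 := cardfsUI B1 B2.
  have e3 := cardfsU1 x (A1 `|` A2).
  rewrite in_fsetU (negbTE xA1) (negbTE xA2) /= in e3.
  lia.
have exM x : exists y, y \in M x.
  have := hM [fset x]; rewrite cardfs1 cardfs_gt0 => /fset0Pn[y].
  by case/mem_image_fset => z; rewrite inE => /eqP ->; exists y.
have [h hh] := choice exM.
exists h; split; last by move=> x; apply: (fsubsetP (MN x)).
move=> x x' hx; apply/eqP; apply: contraT => xx.
have := hM [fset x; x']; rewrite cardfs2 xx.
suff: #|` image_fset M [fset x; x']| <= 1 by lia.
rewrite -(cardfs1 (h x)); apply: fsubset_leq_card; apply/fsubsetP => y.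
case/mem_image_fset => z; rewrite !inE => /orP[/eqP ->|/eqP ->] yz.
  by rewrite (uniqM _ _ _ yz (hh x)).
by rewrite hx (uniqM _ _ _ yz (hh x')).
Qed.

End Hall.

(** The bijection sends each [x] to [h x] or to a [k]-preimage of [x], both related to [x] by [r];
    this is how closeness survives the Cantor-Bernstein argument. *)
Lemma cantor_bernstein_rel (X Y : Type) (r : X -> Y -> Prop) (h : X -> Y) (k :
  Y -> X) :
  injective h -> injective k -> (forall x, r x (h x)) -> (forall y, r (k y) y)
    ->
  exists2 f : X -> Y, bijective f & forall x, r x (f x).
Proof.
move=> hi ki hr kr.
(* Forward [k \o h] orbits of the points outside the range of [k]: there [f] is [h], elsewhere it
   inverts [k]. *)
pose orb x := exists n z, (forall y, k y <> z) /\ x = iter n (k \o h) z.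
have ex x : exists y, (orb x -> y = h x) /\ (~ orb x -> k y = x).
  have [o|o] := pselect (orb x); first by exists (h x); split.
  have [y yx] : exists y, k y = x.
    apply: contrapT => ny; apply: o; exists 0%N, x; split=> // y yx.
    by apply: ny; exists y.
  by exists y; split.
have [f Hf] := choice ex.
have f1 x : orb x -> f x = h x by case: (Hf x).
have f2 x : ~ orb x -> k (f x) = x by case: (Hf x).
have orbS x : orb x -> orb (k (h x)).
  by move=> [n [z [hz ->]]]; exists n.+1, z.
have finj : injective f.
  move=> x x'; have [o|o] := pselect (orb x); have [o'|o'] := pselect (orb x').
  - by rewrite !f1 //; apply: hi.
  - by rewrite f1 // => e; case: (o'); rewrite -(f2 _ o') -e; apply: orbS.
  - by rewrite [f x']f1 // => e; case: (o); rewrite -(f2 _ o) e; apply: orbS.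
  - by move=> e; rewrite -(f2 _ o) -(f2 _ o') e.
have fsurj y : exists x, f x = y.
  have [[[|n] [z [hz e]]]|o] := pselect (orb (k y)).
  - by case: (hz y).
  - exists (iter n (k \o h) z); rewrite f1; last by exists n, z.
    by apply: ki; rewrite e.
  by exists (k y); apply: ki; rewrite f2.
have [g Hg] := choice fsurj.
exists f; first by exists g => // x; apply: finj; rewrite Hg.
move=> x; have [o|o] := pselect (orb x); first by rewrite f1.
by rewrite -{1}(f2 _ o); apply: kr.
Qed.

(** * From the vectors to a bijective coarse equivalence *)

Section Rigidity.
Variable R : realType.
Local Notation C := R[i].
Local Notation cj := (@conjc R).

Lemma iso_pair_vectors (X Y : eqType) (dX : X -> X -> R) (dY : Y -> Y -> R) phi
  psi :
  is_metric dX -> is_metric dY -> ulf dX -> ulf dY -> iso_pair dX dY phi psi ->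
  exists V : Y -> X -> C,
  [/\ forall y a b, psi (emx y y) a b = V y a * cj (V y b),
    forall y F, uniq F -> ns F (V y) <= 1
    & forall y e, 0 < e -> exists F0 : seq X, forall F, uniq F ->
        {subset F0 <= F} -> 1 - e <= ns F (V y)].
Proof.
move=> mX mY uX uY H.
have [V HV] := choice (fun y => psi_emx_vector mX mY uX uY H y).
by exists V; split=> y; case: (HV y).
Qed.

(** Gathers what one direction yields, to be used twice with [X] and [Y] exchanged; column bounds
    for [V] are row bounds for [U]. *)
Lemma iso_pair_half (X Y : choiceType) (dX : X -> X -> R) (dY : Y -> Y -> R)
  phi psi
    (V : Y -> X -> C) (U : X -> Y -> C) :
  is_metric dX -> is_metric dY -> ulf dX -> ulf dY -> iso_pair dX dY phi psi ->
  (forall y a b, psi (emx y y) a b = V y a * cj (V y b)) ->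
  (forall x y, nn (U x y) = nn (V y x)) ->
  (forall y e, 0 < e -> exists F0 : seq X, forall F, uniq F ->
        {subset F0 <= F} -> 1 - e <= ns F (V y)) ->
  (forall x F, uniq F -> ns F (U x) <= 1) ->
  (forall x e, 0 < e -> exists F0 : seq Y, forall F, uniq F ->
        {subset F0 <= F} -> 1 - e <= ns F (U x)) ->
  [/\ exists2 c, 0 < c & forall x, exists y, c <= nn (V y x),
    forall r c, 0 < c -> exists s, forall y y' a b, dY y y' <= r ->
      c <= nn (V y a) -> c <= nn (V y' b) -> dX a b <= s
    & forall (g : Y -> X) c, 0 < c -> (forall y, c <= nn (V y (g y))) ->
      exists M, forall (A : seq X) (G : seq Y), uniq A ->
      (forall y x, x \in A -> dX x (g y) <= M -> y \in G) ->
      (size A <= size G)%N].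
Proof.
move=> mX mY uX uY H VE UV rowV rowU1 rowU.
have colE x F : ns F (U x) = \sum_(y <- F) nn (V y x).
  by apply: eq_bigr => y _; rewrite UV.
have colV x e : 0 < e -> exists G : seq Y, forall F, uniq F ->
    {subset G <= F} -> 1 - e <= \sum_(y <- F) nn (V y x).
  move=> /(rowU x) [F0 K]; exists F0 => F uF sF; rewrite -colE; exact: K.
have colV1 x F : uniq F -> \sum_(y <- F) nn (V y x) <= 1.
  by move=> uF; rewrite -colE; apply: rowU1.
have sV := signed_ql mX mY uX uY H VE colV.
have cV := vdot_complete mX mY uX uY H VE colV.
split.
- exact: (entry_lower_bound mX uX sV rowV colV colV1).
- exact: (vectors_coarse mX mY uX uY H VE colV).
- exact: (hall_condition mX sV rowV cV).
Qed.

(** The points [y] with [g y] within [M] of [x] lie within [s + |L|] of [f x]. So neighbour sets are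
    finite, as Hall's theorem requires, and every matching is close to [f]. *)
Lemma coarse_matching (X Y : choiceType) (dX : X -> X -> R) (dY : Y -> Y -> R)
    (f : X -> Y) (g : Y -> X) :
  is_metric dY -> ulf dY -> coarse dX dY f -> close dY (f \o g) id ->
  (exists M, forall (A : seq X) (G : seq Y), uniq A ->
      (forall y x, x \in A -> dX x (g y) <= M -> y \in G) ->
      (size A <= size G)%N) ->
  exists2 h : X -> Y, injective h & exists K, forall x, dY (f x) (h x) <= K.
Proof.
move=> [_ [_ [_ tri]]] uY cf [L fg] [M HM].
have M0 : 0 < `|M| + 1 by have := normr_ge0 M; lra.
have [s [s0 Hs]] := cf _ M0.
have near x y : dX x (g y) <= M -> dY (f x) y <= s + `|L|.
  move=> h; have h' : dX x (g y) <= `|M| + 1 by have := ler_norm M; lra.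
  have := Hs _ _ h'; have := fg y => /= h1 h2.
  by have := tri (f x) (f (g y)) y; have := ler_norm L; lra.
have r0 : 0 < s + `|L| by have := normr_ge0 L; lra.
have [N0 HN0] := ball_seq uY r0.
have ex x : exists B : {fset Y}, forall y, (y \in B) = (dX x (g y) <= M).
  have [b [ub _ inb]] := HN0 (f x).
  exists (seq_fset tt [seq y <- b | dX x (g y) <= M]) => y.
  by rewrite seq_fsetE mem_filter inb andb_idr // => /near.
have [N HN] := choice ex.
have hallN : hall N.
  move=> A; apply: HM; first exact: fset_uniq.
  by move=> y x xA h; apply/mem_image_fset; exists x; rewrite ?HN.
have [h [hi hN]] := hall_matching hallN.
by exists h => //; exists (s + `|L|) => x; apply: near; rewrite -HN.
Qed.

End Rigidity.

Theorem theorem3p1 (R : realType) (X Y : choiceType)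
  (dX : X -> X -> R) (dY : Y -> Y -> R) :
  is_metric dX -> is_metric dY -> ulf dX -> ulf dY ->
  uroe_isomorphic dX dY -> bij_coarse_equiv dX dY.
Proof.
move=> mX mY uX uY [phi iso].
have [psi H] := star_iso_pair mX mY iso.
have [V [VE V1 Vr]] := iso_pair_vectors mX mY uX uY H.
have [U [UE U1 Ur]] := iso_pair_vectors mY mX uY uX (iso_pair_sym H).
have UV x y : nn (U x y) = nn (V y x).
  apply: (@complexI R); rewrite -!nnE -VE -UE.
  by rewrite (psi_phi_diag _ _ mX mY uX uY H).
have [[c1 c10 lowV] coarseV hallV] :=
  iso_pair_half mX mY uX uY H VE UV Vr U1 Ur.
have [[c2 c20 lowU] coarseU hallU] :=
  iso_pair_half mY mX uY uX (iso_pair_sym H) UE (fun y x => esym (UV x y)) Ur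
    V1 Vr.
(* A common threshold, since [f] and [g] are compared through the same entries
   [|U x y| = |V y x|]. *)
pose c := Num.min c1 c2.
have c0 : 0 < c by rewrite lt_min c10.
have [f0 Hf0] := choice lowV; have [g0 Hg0] := choice lowU.
have {lowV} [f Hf] : exists f : X -> Y, forall x, c <= nn (U x (f x)).
  by exists f0 => x; rewrite UV; apply: le_trans (Hf0 x); rewrite ge_min lexx.
have {lowU} [g Hg] : exists g : Y -> X, forall y, c <= nn (V y (g y)).
  by exists g0 => y; rewrite -UV; apply: le_trans (Hg0 y);
    rewrite ge_min lexx orbT.
have cf : coarse dX dY f.
  move=> r _; have [s Hs] := coarseU r c c0; exists (`|s| + 1).
  split=> [|x x' h]; first by have := normr_ge0 s; lra.
  by have := Hs x x' _ _ h (Hf x) (Hf x'); have := ler_norm s; lra.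
have cg : coarse dY dX g.
  move=> r _; have [s Hs] := coarseV r c c0; exists (`|s| + 1).
  split=> [|y y' h]; first by have := normr_ge0 s; lra.
  by have := Hs y y' _ _ h (Hg y) (Hg y'); have := ler_norm s; lra.
(* At both [f (g y)] and [y] the vector [U (g y)] has squared modulus at least [c], so the coarse
   estimate with radius 0 applies. *)
have fg : close dY (f \o g) id.
  have [s Hs] := coarseU 0 c c0; exists s => y /=.
  apply: (Hs (g y) (g y)); [by case: mX => -> | exact: Hf | by rewrite UV].
have gf : close dX (g \o f) id.
  have [s Hs] := coarseV 0 c c0; exists s => x /=.
  apply: (Hs (f x) (f x)); [by case: mY => -> | exact: Hg | by rewrite -UV].
have [h hi [K1 HK1]] := coarse_matching mY uY cf fg (hallV g c c0 Hg).
have [k ki [K2 HK2]] := coarse_matching mX uX cg gf (hallU f c c0 Hf).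
have [L HL] := fg; have [L' HL'] := gf.
have K20 : 0 < `|K2| + 1 by have := normr_ge0 K2; lra.
have [s [s0 Hs]] := cf _ K20.
case: (mY) => _ [_ [dYC triY]]; case: (mX) => _ [_ [dXC triX]].
(* [|K1|] serves the values of [h]; for the pairs [(k y, y)], [f (k y)] is within [s] of [f (g y)],
   which is within [|L|] of [y]. *)
have [F bF HF] : exists2 F : X -> Y, bijective F &
    forall x, dY (f x) (F x) <= `|K1| + s + `|L|.
  apply: (cantor_bernstein_rel (r := fun x y => dY (f x) y <= `|K1| + s + `|L|)
    hi ki) => [x|y].
    by have := HK1 x; have := ler_norm K1; have := normr_ge0 L; lra.
  have h1 : dY (f (g y)) (f (k y)) <= s.
    by apply: Hs; have := HK2 y; have := ler_norm K2; lra.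
  have := HL y => /= h2; have := triY (f (k y)) (f (g y)) y; rewrite dYC in h1.
  by have := ler_norm L; have := normr_ge0 K1; lra.
set K := `|K1| + s + `|L| in HF.
have K0 : 0 < K by rewrite /K; have := normr_ge0 K1; have := normr_ge0 L; lra.
exists F; split=> //; split.
  move=> r /cf [t [t0 Ht]]; exists (K + t + K); split=> [|x x' xx];
    first by lra.
  have := triY (F x) (f x) (F x'); have := triY (f x) (f x') (F x').
  have := HF x; have := HF x'; have := Ht _ _ xx; rewrite (dYC (F x) (f x));
    lra.
exists g; split=> //; split.
  exists (K + L) => y /=; have := triY (F (g y)) (f (g y)) y.
  by have := HF (g y); have := HL y => /=; rewrite (dYC (F (g y)) (f _)); lra.
have [t [t0 Ht]] := cg K K0; exists (t + L') => x /=.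
have h1 := Ht _ _ (HF x); have := HL' x => /= h2.
by have := triX (g (F x)) (g (f x)) x; rewrite (dXC (g (F x)) (g (f x))); lra.
Qed.
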